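(* Let $p$ be a prime, $K$ a finite extension of $\mathbb{Q}_p$, and $A\subset K((\frac1T))$ a $K$-subalgebra with $A\cap K[[\frac1T]]=K$ and $1\le g:=\dim_KK((\frac1T))/(A+K[[\frac1T]])<\infty$, which is strictly integral. Suppose $\det(\mathbf{e}^{(1)})\in O_K^*$. Then there exists a finite extension $K'$ of $K$ such that, upon replacing $K$ by $K'$, one has $|T_1|=p^g$ and the set $$\{\vec{\pi}=(\pi_1,\ldots,\pi_g)\in T_1 : |\pi_g|=|p|^{1/(p-1)}\}$$ contains at least $p^g-p^{g-1}$ elements.
   Context: $|\cdot|$ is the absolute value on $K$ (extended to finite extensions) with $|p|=1/p$, $O_K=\{|a|\le1\}$, $\mathcal{M}_K=\{|a|<1\}$. $K((\frac1T))$ is the field of series $\sum_{i\le n}v_iT^i$; the degree is the largest exponent with nonzero coefficient. Put $\underline{M}(A)=\{\deg v : 0\ne v\in A\}\subset\mathbb{Z}_{\ge0}$, written $\{s_1<s_2<\cdots\}$; let $\mathbb{Z}_{\ge0}\setminus\underline{M}(A)=\{\mu_1<\cdots<\mu_g\}$. The standard basis of $A$ is the unique basis $v_i=\sum_jv_{ij}T^j$ with $v_i$ monic of degree $s_i$ and $v_{i,s_j}=0$ for $i>j\ge1$; $A$ is strictly integral if all $v_{ij}\in O_K$. Let $O(A)$ be the set of elements of $A$ with all coefficients in $O_K$. One has $O_K[[\frac1T]][T]=O(A)\oplus\frac1TO_K[[\frac1T]]\oplus\bigoplus_{i=1}^gO_KT^{\mu_i}$. For $k\ge0$, $\mathbf{e}^{(k)}=(e^{(k)}_{ij})\in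 M_g(O_K)$ is defined by $T^{\mu_jp^k}-\sum_ie^{(k)}_{ij}T^{\mu_i}\in O(A)\oplus\frac1TO_K[[\frac1T]]$ for $j=1,\dots,g$. Put $\vec{l}(X_1,\ldots,X_g):=\sum_{k\ge0}p^{-k}\mathbf{e}^{(k)}(X_1^{p^k},\ldots,X_g^{p^k})^{t}\in K[[X_1,\ldots,X_g]]^{\oplus g}$ (convergent on $\mathcal{M}_K^{\oplus g}$), and $$T_1:=\{\vec{\pi}\in\mathcal{M}_K^{\oplus g} : \vec{l}(\vec{\pi})=0,\ \max_i|\pi_i|\le|p|^{1/(p-1)}\}.$$ ''Replacing $K$ by $K'$'' means taking $\vec{\pi}\in\mathcal{M}_{K'}^{\oplus g}$ in the definition of $T_1$, with $A$ replaced by its $K'$-span; the matrices $\mathbf{e}^{(k)}$ and the series $\vec{l}$ are unchanged. *)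

(* Defs.v *)
From HB Require Import structures.
From mathcomp Require Export all_boot all_order all_algebra all_field.
From mathcomp Require Export all_classical all_reals all_analysis.

Set Implicit Arguments.
Unset Strict Implicit.
Unset Printing Implicit Defensive.

Export Order.TTheory GRing.Theory Num.Theory.
Export numFieldNormedType.Exports.

#[global] Open Scope classical_set_scope.
#[global] Open Scope ring_scope.

Section AbsoluteValues.
Variable R : realType.

Record is_abs (F : fieldType) (abs : F -> R) : Prop := IsAbs {
  abs_ge0 : forall x, 0 <= abs x;
  abs_eq0 : forall x, abs x = 0 <-> x = 0;
  abs_mul : forall x y, abs (x * y) = abs x * abs y;
  abs_ultra : forall x y, abs (x + y) <= Num.max (abs x) (abs y) }.

Definition abs_cvg (F : fieldType) (abs : F -> R) (u : nat -> F) (l : F) : Prop :=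
  (fun n => abs (u n - l)) @ \oo --> (0 : R).

Definition abs_cauchy (F : fieldType) (abs : F -> R) (u : nat -> F) : Prop :=
  forall eps : R, 0 < eps -> exists N : nat, forall m n : nat,
    (N <= m)%N -> (N <= n)%N -> abs (u m - u n) < eps.

Definition abs_complete (F : fieldType) (abs : F -> R) : Prop :=
  forall u : nat -> F, abs_cauchy abs u -> exists l : F, abs_cvg abs u l.

Definition padic_abs (p : nat) (q : rat) : R :=
  if q == 0 then 0
  else p%:R ^ ((logn p `|denq q|%N)%:Z - (logn p `|numq q|%N)%:Z).

(* (F, abs) is Q_p, i.e. the completion of (rat, padic_abs p); this determines
   it up to a unique isometric isomorphism. *)
Record is_Qp (p : nat) (F : fieldType) (abs : F -> R) : Prop := IsQp {
  Qp_abs : is_abs abs;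
  Qp_rat : forall q : rat, abs (ratr q) = padic_abs p q;
  Qp_dense : forall (x : F) (eps : R), 0 < eps ->
    exists q : rat, abs (x - ratr q) < eps;
  Qp_complete : abs_complete abs }.

Definition abs_extends (F : fieldType) (L : fieldExtType F)
    (abs : F -> R) (absL : L -> R) : Prop :=
  is_abs absL /\ forall a : F, absL a%:A = abs a.

Definition integers (F : fieldType) (abs : F -> R) : set F :=
  [set a | abs a <= 1].

Definition integer_units (F : fieldType) (abs : F -> R) : set F :=
  [set a | integers abs a /\ exists2 b, integers abs b & a * b = 1].

End AbsoluteValues.

(* An element sum_(i <= n) v_i T^i of K((1/T)) is encoded by its coefficient
   function i |-> v_i. *)
Section Laurent.
Variable K : fieldType.
Implicit Types (v w : int -> K) (A : set (int -> K)).

Definition laurent : set (int -> K) :=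
  [set v | exists n : int, forall i, n < i -> v i = 0].

Definition power_series : set (int -> K) :=
  [set v | forall i, 0 < i -> v i = 0].

Definition monomial (n : int) : int -> K := fun i => (i == n)%:R.

(* On laurent only finitely many terms of this sum are nonzero. *)
Definition laurent_mul v w : int -> K :=
  fun n => \sum_(i \in [set: int]) v i * w (n - i).

Record is_subalgebra A : Prop := IsSubalgebra {
  subalg_laurent : A `<=` laurent;
  subalg_one : A (monomial 0);
  subalg_add : forall v w, A v -> A w -> A (v + w);
  subalg_scale : forall (a : K) v, A v -> A (a \*o v);
  subalg_mul : forall v w, A v -> A w -> A (laurent_mul v w) }.

Definition constants : set (int -> K) :=
  range (fun c : K => c \*o monomial 0).

Definition setsum (V W : set (int -> K)) : set (int -> K) :=
  [set u | exists v w, [/\ V v, W w & u = v + w]].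

(* dim_K (V / W) = g, for subspaces W of V: the classes of the b_i form a basis
   of V / W. *)
Definition quotient_dim (V W : set (int -> K)) (g : nat) : Prop :=
  exists b : 'I_g -> int -> K,
    (forall i, V (b i)) /\
    (forall v, V v -> exists! c : 'rV[K]_g, W (v - \sum_(i < g) (c 0 i \*o b i))).

Definition has_degree v (d : int) : Prop :=
  v d <> 0 /\ forall i, d < i -> v i = 0.

Definition degrees A : set int := [set d | exists2 v, A v & has_degree v d].

Definition is_gap_sequence A (g : nat) (mu : 'I_g -> nat) : Prop :=
  {homo mu : i j / (i < j)%N} /\ range mu = [set n : nat | ~ degrees A n%:Z].

Definition is_basis A (v : nat -> int -> K) : Prop :=
  [/\ forall i, A (v i),
      forall (n : nat) (c : 'I_n -> K),
        \sum_(i < n) (c i \*o v i) = 0 -> forall i, c i = 0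
    & forall a, A a ->
        exists (n : nat) (c : 'I_n -> K), a = \sum_(i < n) (c i \*o v i)].

Record is_standard_basis A (s : nat -> int) (v : nat -> int -> K) : Prop :=
  IsStandardBasis {
    std_increasing : {homo s : i j / (i < j)%N >-> i < j};
    std_degrees : range s = degrees A;
    std_basis : is_basis A v;
    std_degree : forall i, has_degree (v i) (s i);
    std_monic : forall i, v i (s i) = 1;
    std_reduced : forall i j, (j < i)%N -> v i (s j) = 0 }.

Variables (R : realType) (abs : K -> R).

Definition strictly_integral A : Prop :=
  exists (s : nat -> int) (v : nat -> int -> K),
    is_standard_basis A s v /\ forall i j, integers abs (v i j).

Definition integral_part A : set (int -> K) :=
  [set v | A v /\ forall i, integers abs (v i)].

Definition integral_tails : set (int -> K) :=
  [set v | (forall i, 0 <= i -> v i = 0) /\ forall i, integers abs (v i)].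

Definition is_e_matrices (p : nat) A (g : nat) (mu : 'I_g -> nat)
    (e : nat -> 'M[K]_g) : Prop :=
  forall k : nat,
    (forall i j, integers abs (e k i j)) /\
    (forall j, setsum (integral_part A) integral_tails
       (monomial (mu j * p ^ k)%N%:Z
        - \sum_(i < g) (e k i j \*o monomial (mu i)%:Z))).

End Laurent.

Section LogZeros.
Variables (R : realType) (p : nat) (K : fieldType) (g : nat).
Variable e : nat -> 'M[K]_g.
Variables (L : fieldExtType K) (abs : L -> R).

Definition l_partial (x : 'cV[L]_g) (n : nat) : 'cV[L]_g :=
  \sum_(k < n) (p%:R ^- k) *:
    (map_mx (in_alg L) (e k) *m (\col_j (x j 0 ^+ (p ^ k)))).

Definition l_value (x y : 'cV[L]_g) : Prop :=
  forall i, abs_cvg abs (fun n => l_partial x n i 0) (y i 0).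

Definition radius : R := abs p%:R `^ (p.-1)%:R^-1.

Definition T1 : set 'cV[L]_g :=
  [set x : 'cV[L]_g | [/\ forall i, abs (x i 0) < 1,
               l_value x 0
             & \big[Num.max/0]_(i < g) abs (x i 0) <= radius]].

End LogZeros.

Definition last_ord (g : nat) (hg : (1 <= g)%N) : 'I_g :=
  Ordinal (etrans (ltn_predL g) hg).

(* Main.v *)
(** Write [x = w y] with [w^(p-1) = -p], so that [max |x_i| <= |p|^(1/(p-1))] means
    that [y] is integral.  Since [e 0 = 1], the equation [l(x) = 0] becomes
    [y = e_1 y^(p) + (terms divisible by w)], where [y^(p)] raises the coordinates to
    the power [p].  The derivative of [y^(p)] vanishes mod [p], so each solution of
    [y = e_1 y^(p)] modulo the maximal ideal lifts to exactly one solution.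

    Solutions mod the maximal ideal are found by an explicit form of Lang's theorem.
    Put [M_0 = 1] and [M_(k+1) = e_1 M_k^(p)]; as the residue field of [K] is finite,
    [M_N = 1] for some [N > 0].  For [D] diagonal with entries roots of unity of order
    dividing [p^N - 1], the matrix [P = sum_(k < N) M_k D^(p^k)] satisfies
    [P = e_1 P^(p)], and averaging [det P] over all [D] shows that some [P] is
    invertible.  Then the solutions are the [P c] with [c] in [F_p^g]; since some
    entry in the last row of [P] is a unit, at most [p^(g-1)] of the [c] give a
    vanishing last coordinate.

    The absolute value of [K'] is [|det (multiplication by x)|^(1/n)] over [Q_p].  It
    is comparable with the maximum norm of the coordinates because the unit sphere is
    compact; comparability gives completeness and uniqueness, and also the ultrametric
    inequality, by applying it to high powers. *)

From mathcomp Require Import perm zify ring lra.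
Require Import Defs.

Set Implicit Arguments.
Unset Strict Implicit.
Unset Printing Implicit Defensive.

(** * Ultrametric absolute values *)

Section AbsTheory.
Variables (R : realType) (F : fieldType) (abs : F -> R).
Hypothesis hF : is_abs abs.
Implicit Types (x y z : F) (r : R).

Let ge0 := abs_ge0 hF.
Let absM := abs_mul hF.

Lemma abs0 : abs 0 = 0. Proof. exact/(abs_eq0 hF). Qed.

Lemma abs_gt0 x : x != 0 -> 0 < abs x.
Proof.
move=> x0; rewrite lt_def ge0 andbT; apply: contra x0 => /eqP h.
exact/eqP/(abs_eq0 hF).
Qed.

Lemma abs1 : abs 1 = 1.
Proof.
have /mulfI : abs 1 != 0 by rewrite gt_eqF ?abs_gt0 ?oner_neq0.
by apply; rewrite -absM !mulr1.
Qed.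

Lemma absX x n : abs (x ^+ n) = abs x ^+ n.
Proof. by elim: n => [|n IH]; rewrite ?expr0 ?abs1 // !exprS absM IH. Qed.

Lemma absN x : abs (- x) = abs x.
Proof.
have h : abs (-1) = 1.
  by apply/eqP; rewrite -(@pexpr_eq1 _ _ 2) // -absX sqrrN expr1n abs1.
by rewrite -mulN1r absM h mul1r.
Qed.

Lemma absB x y : abs (x - y) = abs (y - x).
Proof. by rewrite -absN opprB. Qed.

Lemma absV x : abs x^-1 = (abs x)^-1.
Proof.
have [->|x0] := eqVneq x 0; first by rewrite invr0 abs0 invr0.
apply: (mulfI (lt0r_neq0 (abs_gt0 x0))).
by rewrite -absM !divff ?abs1 // gt_eqF ?abs_gt0.
Qed.

Lemma abs_prod (I : Type) (s : seq I) (P : pred I) (f : I -> F) :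
  abs (\prod_(i <- s | P i) f i) = \prod_(i <- s | P i) abs (f i).
Proof. by elim/big_rec2: _ => [|i y1 y2 _ <-]; rewrite ?abs1 ?absM. Qed.

Lemma absD_le x y r : abs x <= r -> abs y <= r -> abs (x + y) <= r.
Proof. by move=> hx hy; rewrite (le_trans (abs_ultra hF x y)) // ge_max hx hy. Qed.

Lemma absD_lt x y r : abs x < r -> abs y < r -> abs (x + y) < r.
Proof. by move=> hx hy; rewrite (le_lt_trans (abs_ultra hF x y)) // gt_max hx hy. Qed.

Lemma absB_le x y r : abs x <= r -> abs y <= r -> abs (x - y) <= r.
Proof. by move=> ? ?; apply: absD_le; rewrite ?absN. Qed.

Lemma absB_lt x y r : abs x < r -> abs y < r -> abs (x - y) < r.
Proof. by move=> ? ?; apply: absD_lt; rewrite ?absN. Qed.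

Lemma abs_dist_le y x z r : abs (x - y) <= r -> abs (y - z) <= r -> abs (x - z) <= r.
Proof. by move=> h1 h2; rewrite -(subrK y x) -addrA absD_le. Qed.

Lemma abs_dist_lt y x z r : abs (x - y) < r -> abs (y - z) < r -> abs (x - z) < r.
Proof. by move=> h1 h2; rewrite -(subrK y x) -addrA absD_lt. Qed.

Lemma abs_sum_le (I : Type) (s : seq I) (P : pred I) (f : I -> F) r :
  0 <= r -> (forall i, P i -> abs (f i) <= r) ->
  abs (\sum_(i <- s | P i) f i) <= r.
Proof.
move=> r0 h; apply: (big_ind (fun x => abs x <= r)) => //; first by rewrite abs0.
by move=> x y; apply: absD_le.
Qed.

Lemma abs_sum_lt (I : Type) (s : seq I) (P : pred I) (f : I -> F) r :
  0 < r -> (forall i, P i -> abs (f i) < r) ->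
  abs (\sum_(i <- s | P i) f i) < r.
Proof.
move=> r0 h; apply: (big_ind (fun x => abs x < r)) => //; first by rewrite abs0.
by move=> x y; apply: absD_lt.
Qed.

Lemma abs_nat_le1 n : abs n%:R <= 1.
Proof. by elim: n => [|n IH]; rewrite ?abs0 // -natr1 absD_le ?abs1. Qed.

Lemma abs_intr_le1 (z : int) : abs z%:~R <= 1.
Proof. by case: z => n; rewrite ?NegzE ?rmorphN ?absN abs_nat_le1. Qed.

Lemma absM_le x y r s : abs x <= r -> abs y <= s -> abs (x * y) <= r * s.
Proof. by move=> hx hy; rewrite absM ler_pM. Qed.

Lemma absM_le1 x y : abs x <= 1 -> abs y <= 1 -> abs (x * y) <= 1.
Proof. by move=> hx hy; rewrite -[leRHS]mulr1 absM_le. Qed.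

Lemma absM_lt1l x y : abs x < 1 -> abs y <= 1 -> abs (x * y) < 1.
Proof. by move=> hx hy; rewrite absM (le_lt_trans _ hx) // ler_piMr. Qed.

Lemma absM_lt1r x y : abs x <= 1 -> abs y < 1 -> abs (x * y) < 1.
Proof. by move=> hx hy; rewrite mulrC absM_lt1l. Qed.

Lemma absX_le1 x n : abs x <= 1 -> abs (x ^+ n) <= 1.
Proof. by move=> hx; rewrite absX exprn_ile1. Qed.

Lemma abs_le1_cong x y : abs (x - y) < 1 -> abs y <= 1 -> abs x <= 1.
Proof. by move=> h hy; rewrite -(subrK y x) absD_le // ltW. Qed.

Lemma abs_eq1_cong x y : abs (x - y) < 1 -> abs y = 1 -> abs x = 1.
Proof.
move=> h hy; apply: le_anti; rewrite (abs_le1_cong h) ?hy //=.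
rewrite leNgt; apply/negP => hx.
suff : abs y < 1 by rewrite hy ltxx.
by rewrite -[y](subrK x) absD_lt // absB.
Qed.

Lemma congM x y x' y' : abs x <= 1 -> abs y' <= 1 ->
  abs (x - x') < 1 -> abs (y - y') < 1 -> abs (x * y - x' * y') < 1.
Proof.
move=> hx hy h1 h2; have -> : x * y - x' * y' = x * (y - y') + (x - x') * y' by ring.
by apply: absD_lt; [apply: absM_lt1r | apply: absM_lt1l].
Qed.

Lemma congX x y n : abs x <= 1 -> abs y <= 1 -> abs (x - y) <= 1 ->
  abs (x ^+ n - y ^+ n) <= abs (x - y).
Proof.
move=> hx hy hxy; rewrite subrXX -[leRHS]mulr1 absM_le //.
by apply: abs_sum_le => // i _; rewrite absM_le1 ?absX_le1.
Qed.

Lemma det_le1 n (A : 'M[F]_n) : (forall i j, abs (A i j) <= 1) -> abs (\det A) <= 1.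
Proof.
move=> hA; apply: abs_sum_le => // s _; rewrite absM_le1 //.
  by rewrite absX_le1 // absN abs1.
by rewrite abs_prod prodr_ile1 // => i _; rewrite ge0 hA.
Qed.

Lemma mulmx_le1 m n k (A : 'M[F]_(m, n)) (B : 'M[F]_(n, k)) :
  (forall i j, abs (A i j) <= 1) -> (forall i j, abs (B i j) <= 1) ->
  forall i j, abs ((A *m B) i j) <= 1.
Proof. by move=> hA hB i j; rewrite mxE abs_sum_le // => l _; rewrite absM_le1. Qed.

Lemma adj_le1 n (A : 'M[F]_n) : (forall i j, abs (A i j) <= 1) ->
  forall i j, abs (\adj A i j) <= 1.
Proof.
move=> hA i j; rewrite mxE /cofactor absM_le1 //.
  by rewrite absX_le1 // absN abs1.
by apply: det_le1 => k l; rewrite !mxE.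
Qed.

(** The adjugate of [A] is integral, and applying it to [A *m B] returns [B] up to the unit
    [\det A]. *)
Lemma unit_mulmx_small n m (A : 'M[F]_n) (B : 'M[F]_(n, m)) :
  (forall i j, abs (A i j) <= 1) -> abs (\det A) = 1 ->
  (forall i j, abs ((A *m B) i j) < 1) -> forall i j, abs (B i j) < 1.
Proof.
move=> hA dA hAB i j.
have : (\adj A *m (A *m B)) i j = \det A * B i j.
  by rewrite mulmxA mul_adj_mx mul_scalar_mx mxE.
move/(congr1 abs); rewrite absM dA mul1r => <-.
by rewrite mxE abs_sum_lt // => l _; rewrite absM_lt1r // adj_le1.
Qed.

Lemma abs_cvg_lt u l r : abs_cvg abs u l -> 0 < r ->
  exists N, forall n, (N <= n)%N -> abs (u n - l) < r.
Proof.
move=> /cvgrPdist_lt h r0; have [N _ hN] := h _ r0.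
by exists N => n /hN /=; rewrite sub0r normrN ger0_norm.
Qed.

Lemma abs_cvgP u l :
  (forall r, 0 < r -> exists N, forall n, (N <= n)%N -> abs (u n - l) < r) ->
  abs_cvg abs u l.
Proof.
move=> h; apply/cvgrPdist_lt => r r0; have [N hN] := h r r0.
by exists N => // n /= /hN; rewrite sub0r normrN ger0_norm.
Qed.

Lemma expr_small (x r : R) : 0 <= x < 1 -> 0 < r ->
  exists N, forall n, (N <= n)%N -> x ^+ n < r.
Proof.
move=> /andP[x0 x1] r0.
have /cvgrPdist_lt /(_ r r0) [N _ hN] : (fun n => x ^+ n) @ \oo --> (0 : R).
  by apply: cvg_expr; rewrite ger0_norm.
exists N => n /hN /=; rewrite sub0r normrN ger0_norm //.
exact: exprn_ge0.
Qed.

Lemma abs_small0 x : (forall r, 0 < r -> abs x < r) -> x = 0.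
Proof.
move=> h; apply/(abs_eq0 hF)/eqP; rewrite eq_le ge0 andbT leNgt.
by apply/negP => /h; rewrite ltxx.
Qed.

(* In an ultrametric space, a sequence is Cauchy as soon as consecutive terms
   get close. *)
Lemma geometric_cauchy (u : nat -> F) (c x : R) : 0 <= x < 1 -> 0 < c ->
  (forall n, abs (u n.+1 - u n) <= c * x ^+ n) ->
  forall n m, (n <= m)%N -> abs (u m - u n) <= c * x ^+ n.
Proof.
move=> /andP[x0 /ltW x1] /ltW c0 h n m; elim: m => [|m IH].
  by rewrite leqn0 => /eqP ->; rewrite subrr abs0 mulr_ge0 ?exprn_ge0.
rewrite leq_eqVlt => /predU1P [->|].
  by rewrite subrr abs0 mulr_ge0 ?exprn_ge0.
rewrite ltnS => nm; apply: (abs_dist_le (y := u m)); last exact: IH.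
by apply: (le_trans (h m)); rewrite ler_wpM2l ?ler_wiXn2l.
Qed.

Lemma geometric_cvg (u : nat -> F) (c x : R) : abs_complete abs ->
  0 <= x < 1 -> 0 < c ->
  (forall n, abs (u n.+1 - u n) <= c * x ^+ n) ->
  exists l, forall n, abs (u n - l) <= c * x ^+ n.
Proof.
move=> cF hx c0 h; have hC := geometric_cauchy hx c0 h.
have [|l hl] := cF u.
  move=> r r0; have [|N hN] := expr_small hx (r := r / c); first by rewrite divr_gt0.
  exists N => m n Nm Nn; have {}hN := hN N (leqnn _).
  apply: (@le_lt_trans _ _ (c * x ^+ N)); last by rewrite mulrC -ltr_pdivlMr.
  by apply: (abs_dist_le (y := u N)); rewrite ?hC // absB hC.
(* If [u n] were farther from [l] than the bound, a late term of the sequence would be closer to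
   both [u n] and [l] than they are to each other, against the ultrametric inequality. *)
exists l => n; rewrite leNgt; apply/negP => hlt.
have [|N hN] := abs_cvg_lt hl (r := abs (u n - l)).
  by apply: le_lt_trans hlt; case/andP: hx => x0 _; rewrite mulr_ge0 ?exprn_ge0 // ltW.
have := hN (maxn n N) (leq_maxr _ _).
apply/negP; rewrite -leNgt leNgt; apply/negP => h2.
have : abs (u n - l) < abs (u n - l).
  apply: (abs_dist_lt (y := u (maxn n N))) h2.
  by rewrite absB; apply: le_lt_trans (hC _ _ (leq_maxl _ _)) hlt.
by rewrite ltxx.
Qed.

End AbsTheory.

(** * Residues and congruences of matrices *)

Section Residues.
Variables (R : realType) (F : fieldType) (abs : F -> R) (p : nat).
Hypotheses (hF : is_abs abs) (hp : prime p) (absp : abs p%:R < 1).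

Let ge0 := abs_ge0 hF.

Lemma abs_dvdn m : (p %| m)%N -> abs m%:R < 1.
Proof.
move=> /dvdnP [k ->]; rewrite natrM; apply: (absM_lt1r hF) => //.
exact: abs_nat_le1.
Qed.

(** The inner binomial coefficients of exponent [p] are divisible by [p]. *)
Lemma frobeniusD_cong x y : abs x <= 1 -> abs y <= 1 ->
  abs ((x + y) ^+ p - (x ^+ p + y ^+ p)) < 1.
Proof.
move=> hx hy; case: p hp absp abs_dvdn => // q hq _ hd.
rewrite exprDn big_ord_recl big_ord_recr /= subn0 expr0 mulr1 bin0 mulr1n.
rewrite /bump /= add1n subnn expr0 mul1r binn mulr1n.
set s := \sum_(i < q) _; have -> : x ^+ q.+1 + (s + y ^+ q.+1) - (x ^+ q.+1 + y ^+ q.+1) = s by ring.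
apply: (abs_sum_lt hF) => // i _; rewrite -mulr_natr; apply: (absM_lt1r hF).
  by apply: (absM_le1 hF); apply: (absX_le1 hF).
by apply: hd; rewrite prime_dvd_bin //= ltnS.
Qed.

Lemma frobenius_sum_cong (I : Type) (s : seq I) (f : I -> F) :
  (forall i, abs (f i) <= 1) ->
  abs ((\sum_(i <- s) f i) ^+ p - \sum_(i <- s) f i ^+ p) < 1.
Proof.
move=> hf; elim: s => [|i s IH].
  by rewrite !big_nil expr0n subr0; case: p hp => //= q _; rewrite (abs0 hF).
rewrite !big_cons; apply: (abs_dist_lt hF) (frobeniusD_cong (hf i) _) _.
  by apply: (abs_sum_le hF).
by rewrite [_ - _](_ : _ = (\sum_(j <- s) f j) ^+ p - \sum_(j <- s) f j ^+ p) //; ring.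
Qed.

(** Additivity of Frobenius gives x^p - y^p = (x - y)^p modulo the maximal ideal, and a power of
    absolute value below 1 has a base of absolute value below 1. *)
Lemma frobenius_inj_cong x y : abs x <= 1 -> abs y <= 1 ->
  abs (x ^+ p - y ^+ p) < 1 -> abs (x - y) < 1.
Proof.
move=> hx hy h; have hxy : abs (x - y) <= 1 by exact: absB_le.
have := frobeniusD_cong hxy hy; rewrite subrK => h2.
have : abs ((x - y) ^+ p) < 1.
  have -> : (x - y) ^+ p = (x ^+ p - y ^+ p) - (x ^+ p - ((x - y) ^+ p + y ^+ p)) by ring.
  exact: absB_lt.
by rewrite (absX hF) !ltNge; apply: contra => /(exprn_ege1 p).
Qed.

Lemma fermat_cong c : abs (c%:R ^+ p - c%:R) < 1.
Proof.
elim: c => [|c IH].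
  by rewrite expr0n; case: p hp => //= q _; rewrite subr0 (abs0 hF).
rewrite -natr1; apply: (abs_dist_lt hF) (frobeniusD_cong _ _) _.
- exact: abs_nat_le1.
- by rewrite (abs1 hF).
- by rewrite expr1n [_ - _](_ : _ = c%:R ^+ p - c%:R) //; ring.
Qed.

(** A Bezout relation u m = v p + 1 would make 1 a non-unit if m were one. *)
Lemma abs_natr_coprime m : ~~ (p %| m)%N -> abs m%:R = 1.
Proof.
move=> hm; have m0 : (0 < m)%N by case: m hm => //; rewrite dvdn0.
apply: le_anti; rewrite abs_nat_le1 //= leNgt; apply/negP => h.
case: (egcdnP p m0) => u v huv _; move: huv.
rewrite gcdnC (eqP (_ : coprime p m)) ?prime_coprime // => /(congr1 (fun n => n%:R : F)).
rewrite natrM natrD natrM => e; suff: abs (1 : F) < 1 by rewrite (abs1 hF) ltxx.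
have -> : (1 : F) = u%:R * m%:R - v%:R * p%:R by rewrite e; ring.
by apply: (absB_lt hF); apply: (absM_lt1r hF) => //; apply: abs_nat_le1.
Qed.

Lemma abs_digitB (c d : 'I_p) : c != d -> abs ((c : nat)%:R - (d : nat)%:R) = 1.
Proof.
wlog: c d / (d < c)%N => [h cd|dc _].
  have [/h ->//|] := ltnP d c; rewrite leq_eqVlt => /predU1P [e|dc].
    by rewrite (ord_inj e) eqxx in cd.
  by rewrite (absB hF) h // eq_sym.
rewrite -natrB 1?ltnW // abs_natr_coprime // gtnNdvd ?subn_gt0 //.
by rewrite (leq_ltn_trans (leq_subr _ _)).
Qed.

Lemma digit_inj (c d : 'I_p) : abs ((c : nat)%:R - (d : nat)%:R) < 1 -> c = d.
Proof. by move=> h; apply/eqP/negPn/negP => /abs_digitB e; rewrite e ltxx in h. Qed.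

(* Otherwise 0, ..., p-1 and z would be p+1 incongruent roots of the monic
   X^p - X, against the invertibility of their Vandermonde matrix. *)
Lemma fixed_residue z : abs z <= 1 -> abs (z ^+ p - z) < 1 ->
  exists c : 'I_p, abs (z - (c : nat)%:R) < 1.
Proof.
move=> hz hfix; apply: contrapT => hno.
have hzc (c : 'I_p) : abs (z - (c : nat)%:R) = 1.
  apply: le_anti; rewrite (absB_le hF) ?abs_nat_le1 //= leNgt; apply/negP => h.
  by apply: hno; exists c.
pose a : 'rV[F]_p.+1 := \row_j if (j < p)%N then (j : nat)%:R else z.
have ha j : abs (a 0 j) <= 1 by rewrite mxE; case: ifP => // _; apply: abs_nat_le1.
have hfa j : abs (a 0 j ^+ p - a 0 j) < 1.
  by rewrite mxE; case: ifP => // _; apply: fermat_cong.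
have p1 : (1 < p.+1)%N by rewrite ltnS prime_gt0.
(* [B] is the coefficient column of X^p - X, so the transposed Vandermonde matrix sends it to the
   values at the nodes [a]. These are all small, while the leading coefficient is 1. *)
pose B : 'cV[F]_p.+1 := \col_i ((i == p :> nat)%:R - (i == 1 :> nat)%:R).
suff : abs (B ord_max 0) < 1.
  by rewrite mxE eqxx gtn_eqF ?prime_gt1 // subr0 (abs1 hF) ltxx.
apply: (unit_mulmx_small hF (A := (Vandermonde p.+1 a)^T)).
- by move=> i j; rewrite !mxE (absX_le1 hF) //; move: (ha i); rewrite mxE.
- rewrite det_tr det_Vandermonde (abs_prod hF) big1 // => i _.
  rewrite (abs_prod hF) big1 // => j ij; rewrite !mxE.
  have ip : (i < p)%N by rewrite (leq_trans ij) // -ltnS.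
  rewrite ip; case: ifP => jp; last exact: (hzc (Ordinal ip)).
  by apply: (abs_digitB (c := Ordinal jp) (d := Ordinal ip)); rewrite -val_eqE /= gtn_eqF.
- move=> i j; rewrite mxE; suff -> : \sum_k (Vandermonde p.+1 a)^T i k * B k j = a 0 i ^+ p - a 0 i.
    exact: hfa.
  rewrite (eq_bigr (fun k : 'I_p.+1 => a 0 i ^+ k * (k == p :> nat)%:R - a 0 i ^+ k * (k == 1 :> nat)%:R)).
    rewrite sumrB; congr (_ - _).
      rewrite (bigD1 ord_max) //= eqxx mulr1 big1 ?addr0 // => k.
      by rewrite -val_eqE /= => /negbTE ->; rewrite mulr0.
    rewrite (bigD1 (Ordinal p1)) //= mulr1 expr1 big1 ?addr0 // => k.
    by rewrite -val_eqE /= => /negbTE ->; rewrite mulr0.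
  by move=> k _; rewrite /Vandermonde mxE (mxE _ _ k i) (mxE _ _ k j) mulrBr.
Qed.

End Residues.

(** * Matrices modulo the maximal ideal and their entrywise Frobenius *)

Section MatrixCongruence.
Variables (R : realType) (F : fieldType) (abs : F -> R).
Hypothesis (hF : is_abs abs).

Definition mxint m n (A : 'M[F]_(m, n)) := forall i j, abs (A i j) <= 1.
Definition mxcong m n (A B : 'M[F]_(m, n)) := forall i j, abs (A i j - B i j) < 1.

Lemma mxcong_refl m n (A : 'M[F]_(m, n)) : mxcong A A.
Proof. by move=> i j; rewrite subrr (abs0 hF). Qed.

Lemma mxcong_sym m n (A B : 'M[F]_(m, n)) : mxcong A B -> mxcong B A.
Proof. by move=> h i j; rewrite (absB hF). Qed.

Lemma mxcong_trans m n (B A C : 'M[F]_(m, n)) :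
  mxcong A B -> mxcong B C -> mxcong A C.
Proof. by move=> h1 h2 i j; apply: (abs_dist_lt hF) (h1 i j) (h2 i j). Qed.

Lemma mxcong_int m n (A B : 'M[F]_(m, n)) : mxcong A B -> mxint B -> mxint A.
Proof. by move=> h hB i j; apply: (abs_le1_cong hF) (h i j) (hB i j). Qed.

Lemma mxcong_mul m n k (A A' : 'M[F]_(m, n)) (B B' : 'M[F]_(n, k)) :
  mxint A -> mxint B' -> mxcong A A' -> mxcong B B' -> mxcong (A *m B) (A' *m B').
Proof.
move=> hA hB hAA hBB i j; rewrite !mxE -sumrB; apply: (abs_sum_lt hF) => // l _.
exact: congM.
Qed.

Lemma mxint_sum (I : Type) (s : seq I) m n (f : I -> 'M[F]_(m, n)) :
  (forall i, mxint (f i)) -> mxint (\sum_(i <- s) f i).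
Proof.
by move=> h i j; rewrite summxE; apply: (abs_sum_le hF) => // l _; apply: h.
Qed.

Lemma mxint1 n : mxint (1%:M : 'M[F]_n).
Proof. by move=> i j; rewrite mxE abs_nat_le1. Qed.

Lemma mxint_mul m n k (A : 'M[F]_(m, n)) (B : 'M[F]_(n, k)) :
  mxint A -> mxint B -> mxint (A *m B).
Proof. exact: mulmx_le1. Qed.

Lemma mxcong_cancel n m (A : 'M[F]_n) (B C : 'M[F]_(n, m)) :
  mxint A -> abs (\det A) = 1 -> mxcong (A *m B) (A *m C) -> mxcong B C.
Proof.
move=> hA dA h i j; have := unit_mulmx_small hF hA dA (B := B - C).
move=> /(_ _ i j); rewrite !mxE; apply=> k l.
by have := h k l; rewrite mulmxBr !mxE.
Qed.

Variables (p : nat) (hp : prime p) (absp : abs p%:R < 1).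

Definition mxfrob m n (A : 'M[F]_(m, n)) := map_mx (fun x => x ^+ p) A.

Lemma mxfrob_int m n (A : 'M[F]_(m, n)) : mxint A -> mxint (mxfrob A).
Proof. by move=> h i j; rewrite mxE (absX_le1 hF). Qed.

Lemma mxfrobM m n k (A : 'M[F]_(m, n)) (B : 'M[F]_(n, k)) :
  mxint A -> mxint B -> mxcong (mxfrob (A *m B)) (mxfrob A *m mxfrob B).
Proof.
move=> hA hB i j; rewrite 3!mxE.
under [X in _ - X]eq_bigr => l _ do rewrite !mxE -exprMn.
by apply: (frobenius_sum_cong hF hp absp) => l; apply: (absM_le1 hF).
Qed.

Lemma mxfrob_sum (I : Type) (s : seq I) m n (f : I -> 'M[F]_(m, n)) :
  (forall i, mxint (f i)) ->
  mxcong (mxfrob (\sum_(i <- s) f i)) (\sum_(i <- s) mxfrob (f i)).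
Proof.
move=> h i j; rewrite mxE !summxE.
under [X in _ - X]eq_bigr => l _ do rewrite mxE.
by apply: (frobenius_sum_cong hF hp absp) => l; apply: h.
Qed.

Lemma mxfrob_inj m n (A B : 'M[F]_(m, n)) :
  mxint A -> mxint B -> mxcong (mxfrob A) (mxfrob B) -> mxcong A B.
Proof.
move=> hA hB h i j; apply: (frobenius_inj_cong hF hp absp) => //.
by have := h i j; rewrite !mxE.
Qed.

End MatrixCongruence.

(** * Lifting zeros of the logarithm *)

Section LogZeroLifting.
Variables (R : realType) (F : fieldType) (abs : F -> R) (p g : nat).
Hypotheses (hF : is_abs abs) (hp : prime p) (absp : abs p%:R < 1).
Hypotheses (p_neq0 : (p%:R : F) != 0) (cF : abs_complete abs).
Variable w : F.
Hypothesis hw : w ^+ p.-1 = - p%:R.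
Variable E : nat -> 'M[F]_g.
Hypotheses (E0 : E 0%N = 1%:M) (Eint : forall k, mxint abs (E k)).

Let ge0 := abs_ge0 hF.
Local Notation r := (abs w).
Implicit Types y z : 'cV[F]_g.

Lemma abs_root_gt0 : 0 < r.
Proof.
apply: (abs_gt0 hF); apply/negP => /eqP w0; move: hw; rewrite w0 expr0n.
case: eqP => [e|_ /esym/eqP]; last by rewrite oppr_eq0 (negbTE p_neq0).
move=> /(congr1 abs); rewrite (absN hF) (abs1 hF) => h.
by move: absp; rewrite -h ltxx.
Qed.

Lemma abs_root_lt1 : r < 1.
Proof.
have : r ^+ p.-1 < 1 by rewrite -(absX hF) hw (absN hF).
by rewrite !ltNge; apply: contra => /(exprn_ege1 p.-1).
Qed.

(** Coefficient of the k-th term of l(w y) / w. *)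
Definition log_coef k : F := w ^+ (p ^ k).-1 / p%:R ^+ k.

Lemma log_coef0 : log_coef 0 = 1.
Proof. by rewrite /log_coef expn0 expr0 divr1. Qed.

(** Since p^(k+1) - 1 = (p^k - 1) + (p - 1) + (p - 1)(p^k - 1), one factor w^(p-1) = -p cancels the
    additional p in the denominator. *)
Lemma log_coefS k : log_coef k.+1 = - log_coef k * w ^+ (p.-1 * (p ^ k).-1).
Proof.
have p0 := prime_gt0 hp; rewrite /log_coef.
have -> : (p ^ k.+1).-1 = ((p ^ k).-1 + p.-1 + p.-1 * (p ^ k).-1)%N.
  rewrite expnS; have : (0 < p ^ k)%N by rewrite expn_gt0 p0.
  by case: (p ^ k)%N => // q _; case: p p0 => // n _ /=; rewrite mulnS; lia.
rewrite !exprD hw exprSr invfM mulrN !mulNr; congr (- _).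
rewrite -!mulrA; congr (_ * _); rewrite mulrCA (mulrCA p%:R) divff // mulr1.
by rewrite mulrC.
Qed.

Lemma log_coef1 : log_coef 1 = -1.
Proof. by rewrite log_coefS log_coef0 expn0 muln0 expr0 mulr1. Qed.

(** From index 1 on, each step of the recursion contributes at least one further factor [w], because
    (p - 1)(p^k - 1) is positive for k > 0. *)
Lemma log_coef_le k : abs (log_coef k.+1) <= r ^+ k.
Proof.
have r1 := ltW abs_root_lt1.
elim: k => [|k IH]; first by rewrite log_coef1 (absN hF) (abs1 hF).
rewrite log_coefS (abs_mul hF) (absN hF) exprSr ler_pM //.
rewrite (absX hF) -[leRHS]expr1 ler_wiXn2l // muln_gt0.
have p1 := prime_gt1 hp; rewrite -!subn1 !subn_gt0 p1 /=.
by rewrite -{1}(expn0 p) ltn_exp2l.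
Qed.

Definition mxpow k y : 'cV[F]_g := \col_j (y j 0 ^+ (p ^ k)).

Definition log_sum n y : 'cV[F]_g := \sum_(k < n) log_coef k *: (E k *m mxpow k y).

Lemma log_sum_scale n y :
  \sum_(k < n) (p%:R ^- k) *: (E k *m (\col_j ((w *: y) j 0 ^+ (p ^ k)))) =
  w *: log_sum n y.
Proof.
rewrite scaler_sumr; apply: eq_bigr => k _; rewrite scalerA.
have -> : \col_j ((w *: y) j 0 ^+ (p ^ k)) = w ^+ (p ^ k) *: mxpow k y.
  by apply/matrixP => i j; rewrite !mxE exprMn.
rewrite -scalemxAr scalerA; congr (_ *: _); rewrite /log_coef.
by rewrite mulrA -exprS prednK 1?mulrC // expn_gt0 prime_gt0.
Qed.

(** Zeros of [log_sum n] are the fixed points of this map, which is the one to be iterated. *)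
Definition log_step n y := y - log_sum n y.

Lemma log_stepB n y i : log_step n y i 0 = y i 0 - log_sum n y i 0.
Proof. by rewrite /log_step [LHS]mxE [X in _ + X]mxE. Qed.

(** The linear term of [log_sum] is [y] itself, as [E 0] and [log_coef 0] are 1; only powers
    divisible by [p] remain. *)
Lemma log_stepE n y :
  log_step n.+1 y = - \sum_(k < n) log_coef k.+1 *: (E k.+1 *m mxpow k.+1 y).
Proof.
rewrite /log_step /log_sum big_ord_recl log_coef0 E0 scale1r mul1mx opprD addrA.
have -> : mxpow 0 y = y by apply/matrixP => i j; rewrite !mxE expn0 expr1 ord1.
by rewrite subrr add0r.
Qed.

Lemma log_step2 y : log_step 2 y = E 1 *m mxfrob p y.
Proof.
rewrite log_stepE big_ord_recl big_ord0 addr0 log_coef1 scaleN1r opprK.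
by congr (_ *m _); apply/matrixP => i j; rewrite !mxE expn1 ord1.
Qed.

Lemma log_step_int n y : mxint abs y -> mxint abs (log_step n.+1 y).
Proof.
move=> hy i j; rewrite log_stepE mxE (absN hF) summxE; apply: (abs_sum_le hF) => // k _.
rewrite mxE; apply: (absM_le1 hF).
  by apply: le_trans (log_coef_le _) _; rewrite exprn_ile1 // ltW // abs_root_lt1.
by apply: (mxint_mul hF) => // {}i {}j; rewrite mxE (absX_le1 hF).
Qed.

(* The derivative of x^p vanishes mod p, so that x^p contracts residue classes. *)
Lemma expp_contract (x x' : F) (rho d : R) : abs x <= 1 -> abs x' <= 1 ->
  abs p%:R <= rho -> rho <= 1 -> d <= rho -> abs (x - x') <= d ->
  abs (x ^+ p - x' ^+ p) <= rho * d.
Proof.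
move=> hx hx' prho rho1 drho hd; rewrite subrXX mulrC; apply: (absM_le hF) => //.
(* Each term of the cofactor differs from x'^(p-1) by at most d <= rho, and the p copies of x'^(p-1)
   add up to a multiple of [p], of size at most rho. *)
rewrite (eq_bigr (fun i : 'I_p => (x ^+ (p.-1 - i) - x' ^+ (p.-1 - i)) * x' ^+ i + x' ^+ p.-1)).
  rewrite big_split /=; have rho0 : 0 <= rho by apply: le_trans prho.
  apply: (absD_le hF).
    apply: (abs_sum_le hF) => // i _; rewrite -[rho]mulr1; apply: (absM_le hF).
      apply: le_trans (le_trans hd drho); apply: (congX hF) => //.
      exact: absB_le.
    exact: absX_le1.
  rewrite sumr_const card_ord -mulr_natr -[rho]mul1r; apply: (absM_le hF) => //.
  exact: absX_le1.
move=> i _; rewrite mulrBl -exprD subnK; first by rewrite subrK.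
by rewrite -ltnS prednK // prime_gt0.
Qed.

Lemma log_step_contract n y z (rho d : R) : mxint abs y -> mxint abs z ->
  abs p%:R <= rho -> rho <= 1 -> d <= rho ->
  (forall i, abs (y i 0 - z i 0) <= d) ->
  forall i, abs (log_step n.+1 y i 0 - log_step n.+1 z i 0) <= rho * d.
Proof.
move=> hy hz prho rho1 drho hd i.
have rho0 : 0 <= rho by apply: le_trans prho.
have d0 : 0 <= d by apply: le_trans (hd i).
rewrite !log_stepE [X in X - _]mxE [X in _ - X]mxE -opprD (absN hF) !summxE -sumrB.
apply: (abs_sum_le hF) => [|k _]; first exact: mulr_ge0.
rewrite [X in X - _]mxE [X in _ - X]mxE -mulrBr -[leRHS]mul1r; apply: (absM_le hF).
  by apply: le_trans (log_coef_le _) _; rewrite exprn_ile1 // ltW // abs_root_lt1.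
rewrite !mxE -sumrB; apply: (abs_sum_le hF) => [|j _]; first exact: mulr_ge0.
rewrite -mulrBr -[leRHS]mul1r; apply: (absM_le hF); first exact: Eint.
(* The power p^(k+1) is read as the p-th power of the power p^k: the inner power does not increase
   distances and the outer one contracts. *)
rewrite !mxE expnSr !exprM; apply: expp_contract => //; try exact: absX_le1.
apply: le_trans (hd j); apply: (congX hF) => //; exact: absB_le.
Qed.

Lemma log_step_succ n y : mxint abs y ->
  forall i, abs (log_step n.+2 y i 0 - log_step n.+1 y i 0) <= r ^+ n.
Proof.
move=> hy i; rewrite !log_stepE big_ord_recr /= opprD.
set s := \sum_(_ < n) _; rewrite [X in abs (X - _)]mxE addrAC subrr add0r mxE (absN hF) mxE.
rewrite -[leRHS]mulr1; apply: (absM_le hF); first exact: log_coef_le.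
by apply: (mxint_mul hF) => // {}i j; rewrite mxE (absX_le1 hF).
Qed.

Definition log_zero y := forall i, abs_cvg abs (fun n => log_sum n y i 0) 0.

(** The terms of index at least 2 have coefficients in the maximal ideal, so a zero satisfies the
    equation truncated after the index 1. *)
Lemma log_zero_residue y : mxint abs y -> log_zero y ->
  mxcong abs (E 1 *m mxfrob p y) y.
Proof.
move=> hy hz i j; rewrite ord1 -log_step2 {j}.
have [N hN] := abs_cvg_lt hF (hz i) ltr01.
have {hN} : abs (log_sum N.+2 y i 0) < 1.
  by have := hN N.+2; rewrite subr0; apply; rewrite ltnW.
have h n : abs (log_step n.+2 y i 0 - log_step 2 y i 0) < 1.
  elim: n => [|n IH]; first by rewrite subrr (abs0 hF).
  apply: (abs_dist_lt hF) IH; apply: le_lt_trans (log_step_succ _ hy _) _.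
  by rewrite exprn_ilt1 // ?abs_root_lt1.
move=> h2; rewrite (absB hF).
have -> : y i 0 - log_step 2 y i 0 =
  log_sum N.+2 y i 0 + (log_step N.+2 y i 0 - log_step 2 y i 0).
  by rewrite (log_stepB N.+2); ring.
exact: absD_lt.
Qed.

(** Two zeros are approximate fixed points of the same contraction: a distance at most rho^(n+1)
    improves to rho^(n+2), hence it is 0. *)
Lemma log_zero_unique y z : mxint abs y -> mxint abs z ->
  log_zero y -> log_zero z -> mxcong abs y z -> y = z.
Proof.
move=> hy hz y0 z0 hyz.
(* The contraction factor must dominate |p| and the initial distances; all of these are below 1. *)
pose rho : R := \big[Num.max/abs p%:R]_(i < g) abs (y i 0 - z i 0).
have prho : abs p%:R <= rho by exact: bigmax_ge_id.
have rho0 : 0 < rho by apply: lt_le_trans prho; exact: abs_gt0.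
have rho1 : rho < 1 by apply/bigmax_ltP; split => // i _; exact: hyz.
have h n i : abs (y i 0 - z i 0) <= rho ^+ n.+1.
  elim: n i => [|n IH] i; first by rewrite expr1; exact: le_bigmax_cond.
  have e0 : 0 < rho ^+ n.+2 by exact: exprn_gt0.
  have [N1 hN1] := abs_cvg_lt hF (y0 i) e0; have [N2 hN2] := abs_cvg_lt hF (z0 i) e0.
  pose N := (maxn N1 N2).+1.
  have := hN1 N (leqW (leq_maxl _ _)); have := hN2 N (leqW (leq_maxr _ _)).
  rewrite !subr0 => a b.
  have -> : y i 0 - z i 0 = log_sum N y i 0 - log_sum N z i 0 +
       (log_step N y i 0 - log_step N z i 0).
    by rewrite !log_stepB; ring.
  apply: (absD_le hF); first by apply: (absB_le hF); apply: ltW.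
  rewrite (exprS rho n.+1); apply: log_step_contract => //; first exact: ltW.
  by rewrite -[leRHS]expr1 ler_wiXn2l ?ltW.
apply/matrixP => i j; rewrite ord1; apply/eqP; rewrite -subr_eq0; apply/eqP.
apply: (abs_small0 hF) => e e0.
have [|N /(_ N (leqnn _))] := expr_small (x := rho) _ e0; first by rewrite ltW.
apply: le_lt_trans; apply: le_trans (h N i) _.
by rewrite ler_wiXn2l ?ltW.
Qed.

(** Fixed-point iteration starting at [y0], in which the truncation order of the series grows with
    the iterate, so that the limit is a zero of the whole series. *)
Lemma log_zero_lift y0 : mxint abs y0 -> mxcong abs (E 1 *m mxfrob p y0) y0 ->
  exists2 y, mxcong abs y y0 & log_zero y.
Proof.
move=> hy0; rewrite -log_step2 => h0.
pose rho : R := \big[Num.max/Num.max (abs p%:R) r]_(i < g)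
  abs (log_step 2 y0 i 0 - y0 i 0).
have /[dup] : Num.max (abs p%:R) r <= rho by exact: bigmax_ge_id.
rewrite {1}ge_max => /andP [prho rrho] _.
have rho0 : 0 < rho by apply: lt_le_trans prho; exact: abs_gt0.
have rho1 : rho < 1.
  apply/bigmax_ltP; split => [|i _]; last exact: h0.
  by rewrite gt_max absp abs_root_lt1.
pose u n : 'cV[F]_g := (fix f n := if n is m.+1 then log_step m.+2 (f m) else y0) n.
have uS n : u n.+1 = log_step n.+2 (u n) by [].
have uint n : mxint abs (u n).
  by elim: n => [|n IH]; [exact: hy0 | rewrite uS; exact: log_step_int].
(* The first bound is the one that the contraction estimate requires; the second gives
   convergence. *)
have hu n i : abs (u n.+1 i 0 - u n i 0) <= rho /\
    abs (u n.+1 i 0 - u n i 0) <= rho ^+ n.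
  elim: n i => [|n IH] i.
    have h : abs (u 1%N i 0 - u 0%N i 0) <= rho by exact: le_bigmax_cond.
    by split => //; apply: le_trans h _; rewrite expr0 ltW.
  have a : abs (u n.+2 i 0 - log_step n.+2 (u n.+1) i 0) <= r ^+ n.+1.
    by rewrite (uS n.+1); apply: log_step_succ.
  have ra : r ^+ n.+1 <= rho ^+ n.+1 by rewrite lerXn2r // nnegrE // ltW.
  have rb : r ^+ n.+1 <= rho.
    by apply: le_trans ra _; rewrite -[leRHS]expr1 ler_wiXn2l ?ltW.
  split; apply: (abs_dist_le hF (y := log_step n.+2 (u n.+1) i 0)).
  - exact: le_trans a rb.
  - apply: (@le_trans _ _ (rho * rho)); last by rewrite ler_piMl ?ltW.
    rewrite {2}(uS n); apply: log_step_contract => //; first exact: ltW.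
    by move=> j; case: (IH j).
  - exact: le_trans a ra.
  (* For n = 0 the bound rho^n is 1, too weak for the contraction estimate; hence the minimum with
     rho. *)
  - have [d [d1 d2 d3]] : exists d, [/\ d <= rho, d <= rho ^+ n &
        forall i, abs (u n.+1 i 0 - u n i 0) <= d].
      exists (Num.min rho (rho ^+ n)); split; rewrite ?ge_min ?lexx ?orbT // => j.
      by rewrite le_min; have [-> ->] := IH j.
    apply: (@le_trans _ _ (rho * d)); last by rewrite exprS ler_wpM2l // ltW.
    by rewrite {2}(uS n); apply: log_step_contract => //; exact: ltW.
have /choice [l hl] : forall i, exists l, forall n, abs (u n i 0 - l) <= 1 * rho ^+ n.
  move=> i; apply: (geometric_cvg hF cF) => //; first by rewrite ltW.
  by move=> n; rewrite mul1r; case: (hu n i).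
pose y : 'cV[F]_g := \col_i l i.
have yE i n : abs (u n i 0 - y i 0) <= rho ^+ n by rewrite mxE -[leRHS]mul1r.
have yy0 : mxcong abs y y0.
  move=> i j; rewrite ord1; apply: le_lt_trans rho1.
  apply: (abs_dist_le hF (y := u 1%N i 0)); last by case: (hu 0%N i).
  by rewrite (absB hF) -[leRHS]expr1.
have yint : mxint abs y by exact: mxcong_int yy0 hy0.
exists y => // i; apply: (abs_cvgP hF) => e e0.
have [|N hN] := expr_small (x := rho) _ e0; first by rewrite ltW.
exists N.+2 => n; case: n => [|[|n]] //; rewrite 2!ltnS subr0 => Nn.
(* The value of the truncated series at [y] is split through u (n+1), the image of u n under the
   same step map, so both parts are controlled by distances to the limit. *)
have -> : log_sum n.+2 y i 0 = (y i 0 - u n.+1 i 0) +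
    (log_step n.+2 (u n) i 0 - log_step n.+2 y i 0).
  by rewrite uS (log_stepB _ y); ring.
apply: (@le_lt_trans _ _ (rho ^+ n)); last exact: hN.
apply: (absD_le hF).
  rewrite (absB hF); apply: le_trans (yE _ _) _.
  by rewrite ler_wiXn2l ?ltW.
rewrite -[leRHS]mul1r; apply: log_step_contract => //; first exact: ltW.
by rewrite exprn_ile1 // ltW.
Qed.

(** * Parametrisation of the integral zeros by vectors over F_p *)

Variable P : 'M[F]_g.
Hypotheses (Pint : mxint abs P) (detP : abs (\det P) = 1).
Hypothesis (hP : mxcong abs (E 1 *m mxfrob p P) P).

Definition digit_col (c : {ffun 'I_g -> 'I_p}) : 'cV[F]_g := \col_i (c i : nat)%:R.

Lemma digit_col_int c : mxint abs (digit_col c).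
Proof. by move=> i j; rewrite mxE abs_nat_le1. Qed.

Lemma digit_col_frob c : mxcong abs (mxfrob p (digit_col c)) (digit_col c).
Proof. by move=> i j; rewrite !mxE (fermat_cong hF hp absp). Qed.

(** The substitution y = P z turns the equation y = E_1 y^(p) into z = z^(p). *)
Let Ez z : mxint abs z -> mxcong abs (E 1 *m mxfrob p (P *m z)) (P *m mxfrob p z).
Proof.
move=> hz; apply: (mxcong_trans hF (B := E 1 *m (mxfrob p P *m mxfrob p z))).
  apply: (mxcong_mul hF) => //.
  - by apply: (mxint_mul hF); apply: (mxfrob_int hF).
  - exact: mxcong_refl.
  - exact: mxfrobM.
rewrite mulmxA; apply: (mxcong_mul hF) => //.
- by apply: (mxint_mul hF) => //; apply: (mxfrob_int hF).
- exact: mxfrob_int.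
- exact: mxcong_refl.
Qed.

Lemma digit_col_fixed c :
  mxcong abs (E 1 *m mxfrob p (P *m digit_col c)) (P *m digit_col c).
Proof.
apply: (mxcong_trans hF (Ez (@digit_col_int c))).
apply: (mxcong_mul hF) => //; first exact: digit_col_int.
  exact: mxcong_refl.
exact: digit_col_frob.
Qed.

Lemma fixed_digit_col y : mxint abs y -> mxcong abs (E 1 *m mxfrob p y) y ->
  exists c, mxcong abs y (P *m digit_col c).
Proof.
move=> hy hfix; have dP0 : \det P != 0.
  by apply/negP => /eqP e; move: detP; rewrite e (abs0 hF) => /eqP; rewrite eq_sym oner_eq0.
(* This is the solution of y = P z, written with the adjugate to make its integrality visible. *)
pose z := (\det P)^-1 *: (\adj P *m y).
have hz : mxint abs z.
  move=> i j; rewrite mxE (abs_mul hF) (absV hF) detP invr1 mul1r.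
  by apply: (mxint_mul hF) => //; apply: (adj_le1 hF).
have yE : y = P *m z.
  by rewrite -scalemxAr mulmxA mul_mx_adj mul_scalar_mx scalerA mulVf // scale1r.
have : mxcong abs (mxfrob p z) z.
  apply: (mxcong_cancel hF Pint detP); rewrite -yE.
  by apply: (mxcong_trans hF) hfix; rewrite yE; apply/(mxcong_sym hF)/Ez.
move=> hz2; have /choice [c hc] : forall i, exists c : 'I_p, abs (z i 0 - (c : nat)%:R) < 1.
  move=> i; apply: (fixed_residue hF hp absp) => //.
  by have := hz2 i 0; rewrite mxE.
exists (finfun c); rewrite yE; apply: (mxcong_mul hF) => //.
- exact: digit_col_int.
- exact: mxcong_refl.
- by move=> i j; rewrite ord1 (mxE _ _ i 0 : digit_col _ i 0 = _) ffunE.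
Qed.

(** Digit vectors correspond to solutions modulo the maximal ideal, and each of these lifts to
    exactly one zero. *)
Lemma log_zero_param : exists f : {ffun 'I_g -> 'I_p} -> 'cV[F]_g,
  [/\ injective f,
      forall y, (mxint abs y /\ log_zero y) <-> exists c, y = f c
    & forall c, mxcong abs (f c) (P *m digit_col c)].
Proof.
have dint c : mxint abs (P *m digit_col c).
  by apply: (mxint_mul hF) => //; exact: digit_col_int.
have /choice [f hf] : forall c, exists y, mxcong abs y (P *m digit_col c) /\ log_zero y.
  move=> c; have [y h1 h2] := log_zero_lift (@dint c) (@digit_col_fixed c).
  by exists y.
have fint c : mxint abs (f c) by apply: (mxcong_int hF) (hf c).1 _.
exists f; split; last by move=> c; case: (hf c).
- move=> c d e; apply/ffunP => i; apply: (digit_inj hF hp absp).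
  have : mxcong abs (P *m digit_col c) (P *m digit_col d).
    apply: (mxcong_trans hF) (hf d).1; rewrite -e.
    exact/(mxcong_sym hF)/(hf c).1.
  by move/(mxcong_cancel hF Pint detP)/(_ i 0); rewrite !mxE.
- move=> y; split => [[hy y0]|[c ->]]; last by split => //; case: (hf c).
  have [c hc] := fixed_digit_col hy (log_zero_residue hy y0).
  exists c; apply: log_zero_unique => //; first by case: (hf c).
  by apply: (mxcong_trans hF hc); apply/(mxcong_sym hF)/(hf c).1.
Qed.

End LogZeroLifting.

(** * Lang's theorem for the matrix Frobenius *)

Definition frob_iter (F : fieldType) (p g : nat) (M : 'M[F]_g) k : 'M[F]_g :=
  iter k (fun X => M *m mxfrob p X) 1%:M.

(** Carries the period found over K, where residues are finite in number, to the extension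
    containing the roots of unity. *)
Lemma map_frob_iter (F L : fieldType) (f : {rmorphism F -> L}) p g (M : 'M[F]_g) k :
  map_mx f (frob_iter p M k) = frob_iter p (map_mx f M) k.
Proof.
elim: k => [|k IH] /=; first by rewrite map_mx1.
rewrite map_mxM -IH; congr (_ *m _); apply/matrixP => i j.
by rewrite !mxE rmorphXn.
Qed.

Section Lang.
Variables (R : realType) (F : fieldType) (abs : F -> R) (p g : nat).
Hypotheses (hF : is_abs abs) (hp : prime p) (absp : abs p%:R < 1).
Variable M : 'M[F]_g.
Hypotheses (Mint : mxint abs M) (detM : abs (\det M) = 1).

Local Notation Mi := (frob_iter p M).

Lemma frob_iter_int k : mxint abs (Mi k).
Proof.
elim: k => [|k IH]; first exact: mxint1.
by apply: (mxint_mul hF) => //; apply: mxfrob_int.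
Qed.

(** Both multiplication by [M] and Frobenius are injective modulo the maximal ideal, so a
    coincidence of iterates can be pulled back to index 0. *)
Lemma frob_iter_cancel a k : mxcong abs (Mi (a + k)) (Mi a) -> mxcong abs (Mi k) 1%:M.
Proof.
elim: a => [|a IH] //; rewrite addSn /= => /(mxcong_cancel hF Mint detM) h.
by apply: IH; apply: (mxfrob_inj hF hp absp) h; apply: frob_iter_int.
Qed.

Lemma frob_iter_period (T : finType) (cl : F -> T) :
  (forall x y, abs x <= 1 -> abs y <= 1 -> cl x = cl y -> abs (x - y) < 1) ->
  exists2 N, (0 < N)%N & mxcong abs (Mi N) 1%:M.
Proof.
move=> hcl; pose X := {ffun 'I_g * 'I_g -> T}.
(* Pigeonhole: there are more indices than matrices of classes, so two iterates have the same class
   in every entry. *)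
pose f (k : 'I_#|X|.+1) : X := [ffun ij => cl (Mi k ij.1 ij.2)].
have /injectivePn [a [b ab fab]] : ~~ injectiveb f.
  apply/negP => /injectiveP /leq_card; rewrite card_ord ltnNge leqnn.
  by [].
wlog {ab} ab : a b fab / (a < b)%N.
  move=> h; have [/h|/h|/ord_inj e] := ltngtP a b; [exact|exact|].
  by rewrite e eqxx in ab.
exists (b - a)%N; first by rewrite subn_gt0.
apply: (@frob_iter_cancel a); rewrite subnKC 1?ltnW // => i j.
apply: hcl; try exact: frob_iter_int.
by move/ffunP/(_ (i, j)): fab; rewrite !ffunE.
Qed.

Variables (N : nat) (z : F).
Hypotheses (N0 : (0 < N)%N) (hN : mxcong abs (Mi N) 1%:M).
Let n := (p ^ N).-1.
Hypothesis (hz : n.-primitive_root z).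

Let n1 : n.+1 = (p ^ N)%N.
Proof. by rewrite prednK // expn_gt0 prime_gt0. Qed.

Let absz : abs z = 1.
Proof.
have n0 : (0 < n)%N by exact: prim_order_gt0 hz.
apply/eqP; rewrite -(@pexpr_eq1 _ _ n) // ?(abs_ge0 hF) //.
by rewrite -(absX hF) prim_expr_order // (abs1 hF).
Qed.

Let absn : abs n%:R = 1.
Proof.
apply: (abs_natr_coprime hF hp absp); apply/negP => h.
have : (p %| n.+1)%N by rewrite n1 dvdn_exp.
rewrite -addn1 dvdn_addr // dvdn1 => /eqP e.
by move: hp; rewrite e.
Qed.

(** A geometric sum with ratio x = z^(p^k - 1). For 0 < k < N the exponent lies strictly between 0
    and the order [n], so x differs from 1 while x^n = 1. *)
Let sum_prim k : (k < N)%N ->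
  \sum_(a < n) z^-1 ^+ a * (z ^+ a) ^+ (p ^ k) = (k == 0%N)%:R * n%:R.
Proof.
move=> kN; have z0 : z != 0.
  by apply/negP => /eqP e; move: absz; rewrite e (abs0 hF) => /eqP; rewrite eq_sym oner_eq0.
pose x := z ^+ (p ^ k).-1.
have pk0 : (0 < p ^ k)%N by rewrite expn_gt0 prime_gt0.
have xE (a : 'I_n) : z^-1 ^+ a * (z ^+ a) ^+ (p ^ k) = x ^+ a.
  rewrite -exprM mulnC exprM -exprMn /x; congr (_ ^+ _).
  by rewrite -{1}(prednK pk0) exprS mulKf.
rewrite (eq_bigr _ (fun a _ => xE a)).
case: (eqVneq k 0%N) => [k0|k0].
  rewrite /x k0 mul1r (eq_bigr (fun _ => 1)) ?sumr_const ?card_ord // => a _.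
  by rewrite expn0 /= expr1n.
have : (x - 1) * \sum_(a < n) x ^+ a = 0.
  by rewrite -subrX1 /x exprAC (prim_expr_order hz) expr1n subrr.
move/eqP; rewrite mulf_eq0 mul0r => /orP [|/eqP //].
rewrite subr_eq0 -(prim_order_dvd hz) gtnNdvd //.
  rewrite -subn1 subn_gt0 -{1}(expn0 p) ltn_exp2l ?prime_gt1 //.
  by rewrite lt0n.
by rewrite -ltnS n1 prednK // ltn_exp2l // prime_gt1.
Qed.

(** The summand M_k D^(p^k), for D diagonal with entries z^(t j). *)
Let Q (t : {ffun 'I_g -> 'I_n}) k : 'M[F]_g :=
  \matrix_(i, j) (Mi k i j * (z ^+ t j) ^+ (p ^ k)).

Let P t := \sum_(k < N) Q t k.

Let Qint t k : mxint abs (Q t k).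
Proof.
move=> i j; rewrite mxE; apply: (absM_le1 hF); first exact: frob_iter_int.
by apply: (absX_le1 hF); apply: (absX_le1 hF); rewrite absz.
Qed.

Let Pint t : mxint abs (P t).
Proof. exact: mxint_sum. Qed.

Let QS t k : M *m mxfrob p (Q t k) = Q t k.+1.
Proof.
apply/matrixP => i j; rewrite mxE [RHS]mxE /= mxE mulr_suml; apply: eq_bigr => l _.
by rewrite !mxE exprMn expnSr exprM mulrA.
Qed.

Let hP t : mxcong abs (M *m mxfrob p (P t)) (P t).
Proof.
apply: (mxcong_trans hF (B := M *m \sum_(k < N) mxfrob p (Q t k))).
  apply: (mxcong_mul hF) => //.
  - by apply: (mxint_sum hF) => k; apply: (mxfrob_int hF).
  - exact: mxcong_refl.
  - exact: mxfrob_sum.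
rewrite mulmx_sumr; under eq_bigr => k _ do rewrite QS.
(* The map sends the k-th summand to the next one. Splitting off either end of the sum of N + 1
   terms leaves only the difference between Q_N and Q_0, which are congruent since M_N = 1 modulo
   the maximal ideal and z^(p^N) = z. *)
have : \sum_(k < N.+1) Q t k = \sum_(k < N.+1) Q t k by [].
rewrite {1}big_ord_recl big_ord_recr /= => /(canRL (addKr _)).
under eq_bigr => k _ do rewrite /bump /= add1n.
move=> -> i j; rewrite -/(P t).
have -> : (- Q t 0%N + (P t + Q t N)) i j - P t i j = Q t N i j - Q t 0%N i j.
  by rewrite mxE [X in _ + X - _]mxE [X in X + _ - _]mxE; ring.
rewrite !(mxE _ _ i j : Q t _ i j = _) expn0 expr1; apply: (congM hF).
- exact: frob_iter_int.
- by rewrite (absX_le1 hF) // absz.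
- exact: hN.
- rewrite -n1 exprS exprAC (prim_expr_order hz).
  by rewrite expr1n mulr1 subrr (abs0 hF).
Qed.

(* Averaging det P over all choices of roots of unity extracts the k = 0 term
   of each column. *)
Let det_avg : \sum_(t : {ffun 'I_g -> 'I_n}) (\prod_j z^-1 ^+ t j) * \det (P t) = n%:R ^+ g.
Proof.
have PE t i j : P t i j = \sum_(k < N) Mi k i j * (z ^+ t j) ^+ (p ^ k).
  by rewrite summxE; apply: eq_bigr => k _; rewrite mxE.
have -> : n%:R ^+ g = \det ((n%:R : F)%:M : 'M[F]_g) by rewrite det_scalar.
(* After transposition the i-th factor of each Leibniz product comes from column i and involves only
   [t i], so the sum over all [t] factors into sums over single exponents. *)
rewrite -[in RHS]det_tr.
under eq_bigr => t _ do rewrite -det_tr mulr_sumr.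
rewrite exchange_big; apply: eq_bigr => s _ /=.
under eq_bigr => t _ do rewrite mulrCA -big_split /=.
rewrite -mulr_sumr; congr (_ * _).
pose G i (a : 'I_n) := z^-1 ^+ a * \sum_(k < N) Mi k (s i) i * (z ^+ a) ^+ (p ^ k).
transitivity (\sum_(t : {ffun 'I_g -> 'I_n}) \prod_i G i (t i)).
  apply: eq_bigr => t _; apply: eq_bigr => i _; by rewrite mxE PE.
rewrite -bigA_distr_bigA; apply: eq_bigr => i _.
rewrite /G; under eq_bigr => a _ do rewrite mulr_sumr.
rewrite exchange_big /= !mxE.
transitivity (\sum_(k < N) Mi k (s i) i * ((k == 0 :> nat)%:R * n%:R)).
  apply: eq_bigr => k _; rewrite -sum_prim // mulr_sumr.
  by apply: eq_bigr => a _; rewrite mulrCA.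
rewrite (bigD1 (Ordinal N0)) //= mul1r big1 ?addr0.
  by rewrite mxE mulr_natl -mulrnA mulnC mulrnA.
by move=> k; rewrite -val_eqE /= => /negbTE ->; rewrite mul0r mulr0.
Qed.

(** If every \det (P t) were a non-unit, so would be their weighted sum n^g, although n = p^N - 1 is
    prime to p. *)
Lemma lang_matrix : exists P : 'M[F]_g,
  [/\ mxint abs P, abs (\det P) = 1 & mxcong abs (M *m mxfrob p P) P].
Proof.
apply: contrapT => hno.
have hlt t : abs (\det (P t)) < 1.
  rewrite lt_neqAle (det_le1 hF) ?andbT; last exact: Pint.
  by apply/negP => /eqP e; apply: hno; exists (P t); split.
have : abs (n%:R ^+ g) < 1.
  rewrite -det_avg; apply: (abs_sum_lt hF) => // t _; apply: (absM_lt1r hF) => //.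
  rewrite (abs_prod hF) prodr_ile1 // => j _.
  by rewrite (absX hF) (absV hF) absz invr1 expr1n ler01 lexx.
by rewrite (absX hF) absn expr1n ltxx.
Qed.

End Lang.

(** * Extending absolute values to finite extensions *)

(** If b < a, the powers of b / a would fall below 1 / D. This removes constants from comparisons of
    multiplicative functions. *)
Lemma le_of_exprs (R : realType) (a b D : R) : 0 <= a -> 0 <= b ->
  (forall n, a ^+ n <= D * b ^+ n) -> a <= b.
Proof.
move=> a0 b0 h; rewrite leNgt; apply/negP => ba.
have a1 : 0 < a by exact: le_lt_trans ba.
have D0 : 0 < D by have := h 0%N; rewrite !expr0 mulr1; apply: lt_le_trans.
have [||N /(_ N (leqnn _))] := @expr_small _ (b / a) D^-1.
- by rewrite divr_ge0 //= ltr_pdivrMr // mul1r.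
- by rewrite invr_gt0.
rewrite expr_div_n ltr_pdivrMr ?exprn_gt0 // mulrC ltr_pdivlMr //.
by rewrite mulrC ltNge h.
Qed.

(** Total boundedness of the closed unit ball, in the form of a finite colouring whose colour
    classes have mutual distances below e. *)
Definition totally_bounded (R : realType) (F : fieldType) (abs : F -> R) : Prop :=
  forall e : R, 0 < e -> exists (T : finType) (cl : F -> T), forall x y,
    abs x <= 1 -> abs y <= 1 -> cl x = cl y -> abs (x - y) < e.

Section CoordinateNorm.
Variables (R : realType) (F : fieldType) (abs : F -> R).
Hypothesis hF : is_abs abs.
Variable L : fieldExtType F.
Implicit Types x y : L.

Local Notation n := (\dim {:L}).
Local Notation b := (vbasis {:L}).
Local Notation co := (coord (vbasis {:L})).

Let ge0 := abs_ge0 hF.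

Lemma coord_fullE x : x = \sum_(i < n) co i x *: b`_i.
Proof. exact: coord_vbasis (memvf x). Qed.

Lemma coord_full_sum (c : 'I_n -> F) j : co j (\sum_(i < n) c i *: b`_i) = c j.
Proof. by rewrite coord_sum_free // (basis_free (vbasisP _)). Qed.

Definition cnorm x : R := \big[Num.max/0]_(i < n) abs (co i x).

Lemma cnorm_leP x r : 0 <= r -> reflect (forall i, abs (co i x) <= r) (cnorm x <= r).
Proof.
move=> r0; apply: (iffP (bigmax_leP _ _ _ _)) => [[_ h] i|h]; first exact: h.
by split.
Qed.

Lemma coord_le_cnorm x i : abs (co i x) <= cnorm x.
Proof. exact: le_bigmax_cond. Qed.

Lemma cnorm_ge0 x : 0 <= cnorm x.
Proof. exact: bigmax_ge_id. Qed.

Lemma cnorm_eq0 x : cnorm x = 0 -> x = 0.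
Proof.
move=> h; rewrite [x]coord_fullE big1 // => i _.
have -> : co i x = 0; last by rewrite scale0r.
apply: (abs_small0 hF) => r r0; apply: le_lt_trans r0.
by rewrite -h coord_le_cnorm.
Qed.

Lemma cnorm0 : cnorm 0 = 0.
Proof.
apply: le_anti; rewrite cnorm_ge0 andbT; apply/cnorm_leP => // i.
by rewrite linear0 (abs0 hF).
Qed.

Lemma cnorm_gt0 x : x != 0 -> 0 < cnorm x.
Proof.
move=> x0; rewrite lt_def cnorm_ge0 andbT; apply: contra x0 => /eqP h.
by rewrite (cnorm_eq0 h).
Qed.

Lemma cnormD x y r : cnorm x <= r -> cnorm y <= r -> cnorm (x + y) <= r.
Proof.
move=> hx hy; have r0 : 0 <= r by apply: le_trans hx; exact: cnorm_ge0.
apply/cnorm_leP => // i; rewrite linearD; apply: (absD_le hF).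
  exact: le_trans (coord_le_cnorm x i) hx.
exact: le_trans (coord_le_cnorm y i) hy.
Qed.

Lemma cnorm_sum (I : Type) (s : seq I) (P : pred I) (f : I -> L) r :
  0 <= r -> (forall i, P i -> cnorm (f i) <= r) ->
  cnorm (\sum_(i <- s | P i) f i) <= r.
Proof.
move=> r0 h; apply: (big_ind (fun x => cnorm x <= r)) => //; first by rewrite cnorm0.
by move=> x y; apply: cnormD.
Qed.

Lemma cnormZ_le a x : cnorm (a *: x) <= abs a * cnorm x.
Proof.
apply/cnorm_leP; first by rewrite mulr_ge0 // cnorm_ge0.
move=> i; rewrite linearZ /= (abs_mul hF) ler_wpM2l //.
exact: coord_le_cnorm.
Qed.

Lemma cnormZ a x : cnorm (a *: x) = abs a * cnorm x.
Proof.
apply: le_anti; rewrite cnormZ_le /=.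
have [->|a0] := eqVneq a 0; first by rewrite (abs0 hF) mul0r cnorm_ge0.
have := cnormZ_le a^-1 (a *: x); rewrite scalerA mulVf // scale1r (absV hF).
by rewrite mulrC ler_pdivlMr ?(abs_gt0 hF) // mulrC.
Qed.

Lemma cnormN x : cnorm (- x) = cnorm x.
Proof. by rewrite -scaleN1r cnormZ (absN hF) (abs1 hF) mul1r. Qed.

Lemma cnorm_dist x y : cnorm (x - y) = cnorm (y - x).
Proof. by rewrite -cnormN opprB. Qed.

(** The maximum is attained at a coordinate, so the norm is a value of [abs] and a scalar of [F] can
    normalise the vector. *)
Lemma cnorm_normalize x : x != 0 ->
  exists a : F, [/\ a != 0, abs a = cnorm x & cnorm (a^-1 *: x) = 1].
Proof.
move=> x0; have [j hj] : exists j, cnorm x = abs (co j x).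
  have i0 : 'I_n by exists 0%N; exact: (adim_gt0 {:L}%AS).
  have [|j _ hj] := @eq_bigmax _ _ _ (0 : R) i0 predT (fun i => abs (co i x)) isT _.
    by [].
  by exists j.
have c0 := cnorm_gt0 x0; have a0 : co j x != 0.
  by apply/negP => /eqP e; move: c0; rewrite hj e (abs0 hF) ltxx.
exists (co j x); split => //.
by rewrite cnormZ (absV hF) -hj mulVf // gt_eqF.
Qed.

Lemma cnormM : exists2 C, 0 < C & forall x y, cnorm (x * y) <= C * cnorm x * cnorm y.
Proof.
pose C := 1 + \sum_(i < n) \sum_(j < n) cnorm (b`_i * b`_j).
have S0 : 0 <= \sum_(i < n) \sum_(j < n) cnorm (b`_i * b`_j).
  by apply: sumr_ge0 => i _; apply: sumr_ge0 => j _; exact: cnorm_ge0.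
have hC i j : cnorm (b`_(i : 'I_n) * b`_(j : 'I_n)) <= C.
  apply: (@le_trans _ _ (\sum_(i < n) \sum_(j < n) cnorm (b`_i * b`_j))); last by rewrite ler_wpDl.
  rewrite (bigD1 i) //= (bigD1 j) //= -addrA lerDl addr_ge0 //.
    by apply: sumr_ge0 => k _; exact: cnorm_ge0.
  by apply: sumr_ge0 => k _; apply: sumr_ge0 => l _; exact: cnorm_ge0.
have C0 : 0 < C by rewrite ltr_wpDr.
exists C => // x y; rewrite {1}[x]coord_fullE {1}[y]coord_fullE mulr_suml.
have r0 : 0 <= C * cnorm x * cnorm y by rewrite !mulr_ge0 ?cnorm_ge0 ?(ltW C0).
apply: cnorm_sum => // i _; rewrite mulr_sumr; apply: cnorm_sum => // j _.
rewrite -scalerAl -scalerAr !cnormZ mulrA mulrC -mulrA.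
by rewrite ler_pM ?mulr_ge0 ?cnorm_ge0 // ler_pM // coord_le_cnorm.
Qed.

Hypothesis cF : abs_complete abs.

Lemma cnorm_cvg (u : nat -> L) (c x : R) : 0 <= x < 1 -> 0 < c ->
  (forall k, cnorm (u k.+1 - u k) <= c * x ^+ k) ->
  exists l, forall k, cnorm (u k - l) <= c * x ^+ k.
Proof.
move=> hx c0 h.
have /choice [l hl] : forall i, exists l, forall k, abs (co i (u k) - l) <= c * x ^+ k.
  move=> i; apply: (geometric_cvg hF cF hx c0) => k.
  by rewrite -linearB; apply: le_trans (h k); exact: coord_le_cnorm.
exists (\sum_(i < n) l i *: b`_i) => k; apply/cnorm_leP.
  by rewrite mulr_ge0 ?exprn_ge0 ?(ltW c0) //; case/andP: hx.
by move=> i; rewrite linearB /= coord_full_sum.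
Qed.

Section Embedding.
Variable absL : L -> R.
Hypothesis hL : abs_extends abs absL.

Lemma abs_extendsZ a x : absL (a *: x) = abs a * absL x.
Proof. by have [h hx] := hL; rewrite -mulr_algl (abs_mul h) hx. Qed.

Lemma abs_extends_le : exists2 C, 0 < C & forall x, absL x <= C * cnorm x.
Proof.
have [h _] := hL; have g0 := abs_ge0 h.
pose C := 1 + \sum_(i < n) absL b`_i.
have hC i : absL b`_(i : 'I_n) <= C.
  apply: (@le_trans _ _ (\sum_(i < n) absL b`_i)); last by rewrite ler_wpDl.
  by rewrite (bigD1 i) //= lerDl sumr_ge0.
have C0 : 0 < C by rewrite ltr_wpDr // sumr_ge0.
exists C => // x; rewrite {1}[x]coord_fullE; apply: (abs_sum_le h) => [|i _].
  by rewrite mulr_ge0 ?cnorm_ge0 ?ltW.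
by rewrite abs_extendsZ mulrC ler_pM // coord_le_cnorm.
Qed.

End Embedding.

(** * Compactness of the unit ball and comparison of norms *)

Hypothesis tF : totally_bounded abs.

Lemma cnorm_totally_bounded e : 0 < e -> exists (T : finType) (cl : L -> T),
  forall x y, cnorm x <= 1 -> cnorm y <= 1 -> cl x = cl y -> cnorm (x - y) <= e.
Proof.
move=> e0; have [T [cl h]] := tF e0.
exists {ffun 'I_n -> T}, (fun x => [ffun i => cl (co i x)]) => x y hx hy e1.
apply/cnorm_leP; first exact: ltW.
move=> i; rewrite linearB; apply: ltW; apply: h.
- exact: le_trans (coord_le_cnorm _ _) hx.
- exact: le_trans (coord_le_cnorm _ _) hy.
- by move/ffunP/(_ i): e1; rewrite !ffunE.
Qed.

(** Plays the role of the index set of a subsequence. *)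
Definition unbounded_set (S : set nat) := forall K, exists2 k, (K <= k)%N & S k.

Lemma cnorm_refine (u : nat -> L) (S : set nat) e :
  (forall k, cnorm (u k) <= 1) -> 0 < e -> unbounded_set S ->
  exists2 S' : set nat, S' `<=` S & unbounded_set S' /\
    forall k l, S' k -> S' l -> cnorm (u k - u l) <= e.
Proof.
move=> hu e0 hS; have [T [cl h]] := cnorm_totally_bounded e0.
have [t ht] : exists t, unbounded_set [set k | S k /\ cl (u k) = t].
  apply: contrapT => hno.
  have /choice [K hK] : forall t, exists K, forall k, (K <= k)%N -> S k -> cl (u k) <> t.
    move=> t; apply: contrapT => hn; apply: hno; exists t => K.
    apply: contrapT => hm; apply: hn; exists K => k Kk Sk e1; apply: hm.
    by exists k.
  (* If every colour disappeared from some index on, an element of [S] beyond all these finitely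
     many indices would have no colour. *)
  have [k Kk Sk] := hS (\max_t K t).
  by apply: (hK (cl (u k)) k) => //; apply: leq_trans Kk; exact: leq_bigmax.
exists [set k | S k /\ cl (u k) = t]; first by move=> k [].
by split => // k l [_ ek] [_ el]; apply: h => //; rewrite ek el.
Qed.

(** Bolzano-Weierstrass: nested index sets S_j on which the sequence varies by less and less, and a
    diagonal choice of indices, give a convergent subsequence. *)
Lemma cnorm_cluster (u : nat -> L) : (forall k, cnorm (u k) <= 1) ->
  exists a, forall e K, 0 < e -> exists2 k, (K <= k)%N & cnorm (u k - a) < e.
Proof.
move=> hu; pose x : R := 2^-1.
have hx : 0 <= x < 1 by rewrite /x; apply/andP; split; lra.
have x0 : 0 < x by rewrite /x; lra.
have /choice [f hf] : forall jS : nat * set nat, exists S' : set nat,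
    unbounded_set jS.2 -> S' `<=` jS.2 /\ (unbounded_set S' /\
    forall k l, S' k -> S' l -> cnorm (u k - u l) <= x ^+ jS.1).
  move=> [j S] /=; have [hS|hS] := pselect (unbounded_set S); last by exists set0 => /hS.
  have [S' h1 h2] := cnorm_refine hu (exprn_gt0 j x0) hS.
  by exists S'.
pose S := fix S j := if j is i.+1 then f (i, S i) else [set: nat].
have Su j : unbounded_set (S j).
  elim: j => [K|j IH]; first by exists K.
  by have [_ []] := hf (j, S j) IH.
have /choice [k hk] : forall j, exists k, (j <= k)%N /\ S j.+1 k.
  by move=> j; have [k h1 h2] := Su j.+1 j; exists k.
have [|l hl] := @cnorm_cvg (fun j => u (k j)) 1 x hx ltr01.
  move=> j; rewrite mul1r; have [_ [_]] := hf (j, S j) (Su j); apply.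
    by have [h _] := hf (j.+1, S j.+1) (Su j.+1); apply: h; case: (hk j.+1).
  by case: (hk j).
exists l => e K e0; have [N hN] := expr_small hx e0.
exists (k (maxn K N)).
  by apply: leq_trans (hk _).1; exact: leq_maxl.
by apply: le_lt_trans (hl _) _; rewrite mul1r; apply: hN; exact: leq_maxr.
Qed.

(* Near a nonzero a, the inverse is bounded by |a^-1|; compactness of the unit
   sphere makes this uniform. *)
Lemma cnormV : exists2 B, 0 < B & forall x, cnorm x * cnorm x^-1 <= B.
Proof.
have [C C0 hC] := cnormM.
suff [B B0 hB] : exists2 B, 0 < B & forall x, cnorm x = 1 -> cnorm x^-1 <= B.
  exists B => // x; have [->|x0] := eqVneq x 0.
    by rewrite cnorm0 mul0r ltW.
  have [a [a0 ax a1]] := cnorm_normalize x0.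
  by have := hB _ a1; rewrite invrZ ?unitfE ?invr_eq0 // invrK cnormZ ax.
apply: contrapT => hno.
have /choice [u hu] : forall k : nat, exists x, cnorm x = 1 /\ k.+1%:R < cnorm x^-1.
  move=> k; apply: contrapT => hn; apply: hno; exists k.+1%:R; first by rewrite ltr0n.
  move=> x x1; rewrite leNgt; apply/negP => h; apply: hn; by exists x.
have [|a ha] := @cnorm_cluster u; first by move=> k; rewrite (hu k).1.
have a0 : a != 0.
  apply/negP => /eqP a0; have [k _] := ha 1 0%N ltr01.
  by rewrite a0 subr0 (hu k).1 ltxx.
pose D := C * C * cnorm a^-1.
have D0 : 0 < D by rewrite !mulr_gt0 // cnorm_gt0 // invr_eq0.
(* The index is taken close enough to [a] for the correction term below to be smaller than the
   inverse itself, and beyond |a^-1| so that the bound |u_k^-1| <= |a^-1| contradicts the choice of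
   u_k. *)
have [|k Kk hk] := ha D^-1 (Num.bound (cnorm a^-1)) _; first by rewrite invr_gt0.
have x0 : u k != 0.
  by apply/negP => /eqP e; move: (hu k).1; rewrite e cnorm0 => /eqP; rewrite eq_sym oner_eq0.
have xV : (u k)^-1 = a^-1 + a^-1 * ((a - u k) * (u k)^-1).
  by rewrite mulrBl divff // mulrBr mulr1 mulKf // addrC subrK.
have c0 : 0 < cnorm (u k)^-1 by rewrite cnorm_gt0 // invr_eq0.
have h1 : cnorm (a^-1 * ((a - u k) * (u k)^-1)) < cnorm (u k)^-1.
  apply: le_lt_trans (hC _ _) _.
  apply: (@le_lt_trans _ _ (D * cnorm (a - u k) * cnorm (u k)^-1)).
    rewrite /D (_ : C * C * _ * _ * _ = C * cnorm a^-1 * (C * cnorm (a - u k) * cnorm (u k)^-1)); last by ring.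
    by rewrite ler_wpM2l // ?hC // mulr_ge0 ?cnorm_ge0 ?ltW.
  by rewrite -[ltRHS]mul1r ltr_pM2r // mulrC -ltr_pdivlMr // mul1r cnorm_dist.
have : cnorm (u k)^-1 <= cnorm a^-1.
  rewrite leNgt; apply/negP => h2.
  have : cnorm (u k)^-1 < cnorm (u k)^-1.
    rewrite {1}xV; apply: (@le_lt_trans _ _ (Num.max (cnorm a^-1) (cnorm (a^-1 * ((a - u k) * (u k)^-1))))).
      by apply: cnormD; rewrite le_max lexx ?orbT.
    by rewrite gt_max h2 h1.
  by rewrite ltxx.
apply/negP; rewrite -ltNge; apply: lt_trans (hu k).2.
have := archi_boundP (cnorm_ge0 a^-1) => /lt_trans; apply.
by rewrite ltr_nat ltnS.
Qed.

Section Extension.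
Variable absL : L -> R.
Hypothesis hL : abs_extends abs absL.

(** The upper bound at x^-1 becomes a lower bound at x, since the product of the norms of x and x^-1
    is bounded. *)
Lemma abs_extends_ge : exists2 c, 0 < c & forall x, cnorm x <= c * absL x.
Proof.
have [C C0 hC] := abs_extends_le hL; have [B B0 hB] := cnormV.
have [h _] := hL.
exists (B * C) => [|x]; first exact: mulr_gt0.
have [->|x0] := eqVneq x 0; first by rewrite cnorm0 (abs0 h) mulr0.
have a0 := abs_gt0 h x0.
rewrite -ler_pdivrMr // -(absV h).
apply: (@le_trans _ _ (cnorm x * (C * cnorm x^-1))).
  by rewrite ler_wpM2l ?cnorm_ge0.
by rewrite mulrCA mulrC ler_wpM2r // ltW.
Qed.

Lemma abs_extends_complete : abs_complete absL.
Proof.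
have [h _] := hL; have [C C0 hC] := abs_extends_le hL.
have [c c0 hc] := abs_extends_ge.
move=> u hu; have /choice [l hl] : forall i, exists l, abs_cvg abs (fun k => co i (u k)) l.
  move=> i; apply: cF => e e0; have [|N hN] := hu (e / c); first by rewrite divr_gt0.
  exists N => k m Nk Nm; rewrite -linearB; apply: le_lt_trans (coord_le_cnorm _ _) _.
  by apply: le_lt_trans (hc _) _; rewrite mulrC -ltr_pdivlMr // hN.
exists (\sum_(i < n) l i *: b`_i); apply: (abs_cvgP h) => e e0.
have e1 : 0 < e / (2 * C) by rewrite divr_gt0 // mulr_gt0.
have /choice [N hN] : forall i, exists N, forall k, (N <= k)%N ->
    abs (co i (u k) - l i) < e / (2 * C).
  by move=> i; apply: (abs_cvg_lt hF).
exists (\max_i N i) => k Nk; apply: le_lt_trans (hC _) _.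
apply: (@le_lt_trans _ _ (C * (e / (2 * C)))).
  rewrite ler_wpM2l ?(ltW C0) //; apply/cnorm_leP; first exact: ltW.
  move=> i; rewrite linearB /= coord_full_sum; apply: ltW; apply: hN.
  by apply: leq_trans Nk; exact: leq_bigmax.
rewrite (_ : C * _ = e / 2); last by field; rewrite gt_eqF.
lra.
Qed.

Lemma abs_extends_totally_bounded (pi : F) : 0 < abs pi < 1 -> totally_bounded absL.
Proof.
move=> /andP [pi0 pi1] e e0.
have [h _] := hL; have [C C0 hC] := abs_extends_le hL.
have [c c0 hc] := abs_extends_ge.
(* A power of [pi] scales the unit ball of [absL] into the unit ball of the coordinate norm, where a
   finite colouring is known. *)
have [||m /(_ m (leqnn _)) hm] := @expr_small _ (abs pi) c^-1.
- by rewrite ltW.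
- by rewrite invr_gt0.
rewrite -(absX hF) in hm; set s := pi ^+ m in hm.
have s0 : 0 < abs s by rewrite (absX hF) exprn_gt0.
have [|T [cl hcl]] := @cnorm_totally_bounded (abs s * (e / 2) / C).
  by rewrite !mulr_gt0 // invr_gt0.
have hs x : absL x <= 1 -> cnorm (s *: x) <= 1.
  move=> hx; rewrite cnormZ; apply: (@le_trans _ _ (c^-1 * c)); last by rewrite mulVf ?gt_eqF.
  rewrite ler_pM ?cnorm_ge0 ?(ltW hm) //.
  by apply: le_trans (hc x) _; rewrite ger_pMr.
exists T, (fun x => cl (s *: x)) => x y hx hy e1.
have := hcl _ _ (hs x hx) (hs y hy) e1; rewrite -scalerBr cnormZ -mulrA ler_pM2l //.
rewrite ler_pdivlMr // mulrC => h2; apply: le_lt_trans (hC _) _.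
by apply: le_lt_trans h2 _; lra.
Qed.

End Extension.

(** Both extensions are comparable with the coordinate norm, and high powers remove the
    constants. *)
Lemma abs_extends_unique (absL absL' : L -> R) :
  abs_extends abs absL -> abs_extends abs absL' -> absL =1 absL'.
Proof.
suff h (f f' : L -> R) : abs_extends abs f -> abs_extends abs f' -> forall x, f x <= f' x.
  by move=> h1 h2 x; apply: le_anti; rewrite !h.
move=> hf hf' x; have [C C0 hC] := abs_extends_le hf.
have [c c0 hc] := abs_extends_ge hf'.
have [[a1 _] [a2 _]] := (hf, hf').
apply: (@le_of_exprs _ _ _ (C * c)); try exact: abs_ge0.
move=> k; rewrite -(absX a1) -(absX a2) -mulrA; apply: le_trans (hC _) _.
by rewrite ler_wpM2l ?(ltW C0).
Qed.

(** * Existence of the extended absolute value by means of the field norm *)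

Definition mul_mx x : 'M[F]_n := \matrix_(i, j) co j (b`_i * x).

Lemma mul_mxM x y : mul_mx (x * y) = mul_mx x *m mul_mx y.
Proof.
apply/matrixP => i j; rewrite !mxE mulrA {1}[b`_i * x]coord_fullE mulr_suml linear_sum.
by apply: eq_bigr => k _; rewrite -scalerAl linearZ !mxE.
Qed.

Lemma mul_mx_scalar a : mul_mx a%:A = a%:M.
Proof.
apply/matrixP => i j; rewrite !mxE -scalerAr mulr1 linearZ /=.
by rewrite coord_free ?(basis_free (vbasisP _)) // mulr_natr.
Qed.

Lemma abs_extension_exists : exists absL : L -> R, abs_extends abs absL.
Proof.
have n0 : (0 < n)%N by exact: (adim_gt0 {:L}%AS).
(* The determinant is the field norm, whose value at a scalar a is a^n; the n-th root makes [f]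
   extend [abs]. *)
pose f x := abs (\det (mul_mx x)) `^ n%:R^-1.
have f0 x : 0 <= f x by exact: powR_ge0.
have fE x : f x ^+ n = abs (\det (mul_mx x)).
  by rewrite -powR_mulrn // -powRrM mulVf ?pnatr_eq0 -?lt0n // powRr1.
have finj (r s : R) : 0 <= r -> 0 <= s -> r ^+ n = s ^+ n -> r = s.
  by move=> r0 s0; apply: pexpIrn.
have fM x y : f (x * y) = f x * f y.
  by apply: finj; rewrite ?mulr_ge0 // exprMn !fE mul_mxM det_mulmx (abs_mul hF).
have fa a : f a%:A = abs a.
  by apply: finj => //; rewrite fE mul_mx_scalar det_scalar (absX hF).
have f1 : f 1 = 1 by rewrite -[1]scale1r fa (abs1 hF).
have fX x k : f (x ^+ k) = f x ^+ k.
  by elim: k => [|k IH]; rewrite ?expr0 // !exprS fM IH.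
have [C C0 hC] := cnormM; have [B B0 hB] := cnormV.
have [D D0 hD] : exists2 D, 0 < D & forall x, f x <= D * cnorm x.
  pose D := C * (1 + \sum_(i < n) cnorm b`_i).
  have S0 : 0 <= \sum_(i < n) cnorm b`_i by apply: sumr_ge0 => i _; exact: cnorm_ge0.
  have D0 : 0 < D by rewrite mulr_gt0 // ltr_wpDr.
  exists D => // x; have r0 : 0 <= D * cnorm x by rewrite mulr_ge0 ?cnorm_ge0 ?ltW.
  rewrite -(@ler_pXn2r _ n) ?nnegrE // fE; apply: (abs_sum_le hF) => [|s _].
    exact: exprn_ge0.
  rewrite (abs_mul hF) (absX hF) (absN hF) (abs1 hF) expr1n mul1r (abs_prod hF).
  rewrite -[X in _ <= _ ^+ X]card_ord -prodr_const; apply: ler_prod => i _.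
  rewrite ge0 /= mxE; apply: le_trans (coord_le_cnorm _ _) _.
  apply: le_trans (hC _ _) _; rewrite ler_wpM2r ?cnorm_ge0 // ler_wpM2l ?(ltW C0) //.
  by apply: ltW; rewrite ltr_pwDl // (bigD1 i) //= lerDl sumr_ge0 // => k _; exact: cnorm_ge0.
have fge x : cnorm x <= B * D * f x.
  have [->|x0] := eqVneq x 0; first by rewrite cnorm0 !mulr_ge0 ?(ltW B0) ?(ltW D0).
  have e : f x * f x^-1 = 1 by rewrite -fM divff.
  rewrite -[cnorm x]mulr1 -e mulrA (mulrAC _ (f x)) ler_wpM2r //.
  apply: (@le_trans _ _ (cnorm x * (D * cnorm x^-1))).
    by rewrite ler_wpM2l ?cnorm_ge0.
  by rewrite mulrCA mulrC ler_wpM2r // ltW.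
exists f; split => //; split => //.
- move=> x; split => [fx|->]; last by rewrite -[0](scale0r 1) fa (abs0 hF).
  apply: cnorm_eq0; apply: le_anti; rewrite cnorm_ge0 andbT.
  by have := fge x; rewrite fx mulr0.
- move=> x y; set m := Num.max _ _.
  have m0 : 0 <= m by rewrite le_max f0.
  (* The binomial expansion bounds the k-th power of x + y by m^k up to a constant that does not
     depend on k. *)
  apply: (@le_of_exprs _ _ _ (D * (B * D))) => // k; rewrite -fX -mulrA.
  apply: le_trans (hD _) _; rewrite ler_wpM2l ?(ltW D0) // exprDn.
  have r0 : 0 <= B * D * m ^+ k by rewrite !mulr_ge0 ?exprn_ge0 ?(ltW B0) ?(ltW D0).
  apply: cnorm_sum => // i _; rewrite -scaler_nat cnormZ.
  apply: (@le_trans _ _ (1 * cnorm (x ^+ (k - i) * y ^+ i))).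
    by rewrite ler_wpM2r ?cnorm_ge0 // abs_nat_le1.
  rewrite mul1r; apply: le_trans (fge _) _; rewrite ler_wpM2l ?mulr_ge0 ?(ltW B0) ?(ltW D0) //.
  have ik : (i <= k)%N by rewrite -ltnS.
  rewrite fM !fX -[in leRHS](subnK ik) exprD.
  by rewrite ler_pM ?exprn_ge0 // lerXn2r ?nnegrE // le_max lexx ?orbT.
Qed.

End CoordinateNorm.

(** * p-adic numbers and roots of polynomials *)

Section Qp.
Variables (R : realType) (p : nat) (F : fieldType) (abs : F -> R).
Hypotheses (hp : prime p) (hQ : is_Qp p abs).

Let hF := Qp_abs hQ.

Lemma Qp_abs_prime : abs p%:R = p%:R^-1.
Proof.
have := Qp_rat hQ (p%:Z)%:~R; rewrite ratr_int -pmulrn => ->; rewrite /padic_abs.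
rewrite intr_eq0 eqz_nat eqn0Ngt prime_gt0 //= numq_int denq_int /= logn1.
by rewrite logn_prime // eqxx sub0r exprN1.
Qed.

Lemma Qp_abs_prime_itv : 0 < abs p%:R < 1.
Proof.
rewrite Qp_abs_prime invr_gt0 ltr0n prime_gt0 //= invf_lt1 ?ltr0n ?prime_gt0 //.
by rewrite ltr1n prime_gt1.
Qed.

Lemma Qp_intr_neq0 (z : int) : z != 0 -> z%:~R != 0 :> F.
Proof.
move=> z0; apply/negP => /eqP e; have := Qp_rat hQ z%:~R.
rewrite ratr_int e (abs0 hF) /padic_abs intr_eq0 (negbTE z0) => /esym/eqP.
by rewrite expfz_eq0 pnatr_eq0 [p == _]gtn_eqF ?prime_gt0 // andbF.
Qed.

Lemma abs_intr_coprime (z : int) : ~~ (p %| `|z|)%N -> abs z%:~R = 1.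
Proof.
have /andP [_ p1] := Qp_abs_prime_itv; move=> h; have := abs_natr_coprime hF hp p1 h.
by case: z h => k _ //; rewrite NegzE rmorphN (absN hF).
Qed.

Lemma Qp_digit m x : abs x <= 1 ->
  exists d : 'I_(p ^ m), abs (x - (d : nat)%:R) <= abs p%:R ^+ m.
Proof.
move=> hx; have /andP [p0 p1] := Qp_abs_prime_itv.
have [q hq] := Qp_dense hQ x (exprn_gt0 m p0).
have q1 : abs (ratr q) <= 1.
  rewrite -(subKr x (ratr q)); apply: (absB_le hF) => //; apply: (le_trans (ltW hq)).
  by rewrite exprn_ile1 ?(ltW p1) ?(ltW p0).
have b0 : ((denq q)%:~R : F) != 0 by rewrite Qp_intr_neq0 // denq_neq0.
have qE : (numq q)%:~R = ratr q * (denq q)%:~R :> F by rewrite /ratr divfK.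
(* If p divided the denominator, the reduced numerator would be a unit, yet it equals an integral
   element times a non-unit. *)
have pb : ~~ (p %| `|denq q|)%N.
  apply/negP => pb; have : abs (numq q)%:~R = 1.
    apply: abs_intr_coprime; apply/negP => pa.
    have : (p %| gcdn `|numq q| `|denq q|)%N by rewrite dvdn_gcd pa pb.
    by rewrite (eqP (coprime_num_den q)) dvdn1 => /eqP e; move: hp; rewrite e.
  rewrite qE; apply/eqP; rewrite lt_eqF //; apply: (absM_lt1r hF) => //.
  have := abs_dvdn hF p1 pb; case: (denq q) => k //.
  by rewrite NegzE rmorphN (absN hF).
have absb := abs_intr_coprime pb.
have [u [v]] := Bezoutz (p ^ m)%N%:Z (denq q).
have -> : gcdz (p ^ m)%N%:Z (denq q) = 1.
  rewrite /gcdz absz_nat; congr (Posz _); apply/eqP.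
  by rewrite -/(coprime _ _) coprimeXl // prime_coprime.
move=> uv; have pm0 : (p ^ m)%N%:Z != 0 by rewrite -lt0n expn_gt0 prime_gt0.
(* By the Bezout relation [v] inverts the denominator modulo p^m, so [d0] represents the fraction q
   modulo p^m. *)
pose d0 : int := v * numq q; pose d := (d0 %% (p ^ m)%N%:Z)%Z.
have d_ge0 : 0 <= d by exact: modz_ge0.
have d_lt : (`|d| < p ^ m)%N.
  by rewrite -ltz_nat gez0_abs // ltz_mod.
exists (Ordinal d_lt) => /=.
have -> : (`|d|%N%:R : F) = d%:~R by rewrite -[in RHS](gez0_abs d_ge0).
apply: (abs_dist_le hF (ltW hq)).
have -> : ratr q - d%:~R = ((numq q)%:~R - d%:~R * (denq q)%:~R) / (denq q)%:~R :> F.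
  by rewrite qE -mulrBl mulfK.
rewrite (abs_mul hF) (absV hF) absb invr1 mulr1.
have -> : (numq q)%:~R - d%:~R * (denq q)%:~R =
    p%:R ^+ m * (numq q * u + (d0 %/ (p ^ m)%N%:Z)%Z * denq q)%:~R :> F.
  have -> : (p%:R ^+ m : F) = ((p ^ m)%N%:Z)%:~R by rewrite -natrX.
  rewrite -!rmorphM -rmorphB /=; congr (_%:~R).
  have e1 : d = d0 - (d0 %/ (p ^ m)%N%:Z)%Z * (p ^ m)%N%:Z.
    by rewrite {1}(divz_eq d0 (p ^ m)%N%:Z) addrC addKr.
  rewrite {}e1 mulrBl {1}/d0 -[in LHS](mulr1 (numq q)) -{1}uv; ring.
rewrite (abs_mul hF) (absX hF) -[leRHS]mulr1 ler_wpM2l ?exprn_ge0 ?(ltW p0) //.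
exact: abs_intr_le1.
Qed.

Lemma Qp_totally_bounded : totally_bounded abs.
Proof.
move=> e e0; have /andP [p0 p1] := Qp_abs_prime_itv.
have [|m /(_ m (leqnn _)) hm] := expr_small (x := abs p%:R) _ e0; first by rewrite ltW.
have /choice [cl hcl] : forall x, exists d : 'I_(p ^ m),
    abs x <= 1 -> abs (x - (d : nat)%:R) <= abs p%:R ^+ m.
  move=> x; have [/(Qp_digit m) [d hd]|] := boolP (abs x <= 1); first by exists d.
  have pm : (0 < p ^ m)%N by rewrite expn_gt0 prime_gt0.
  by exists (Ordinal pm).
exists 'I_(p ^ m), cl => x y hx hy exy; apply: le_lt_trans hm.
by apply: (abs_dist_le hF (hcl x hx)); rewrite exy (absB hF) hcl.
Qed.

End Qp.

(** * Adjoining roots of polynomials *)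

Lemma irreducible_factor (K : fieldType) (f : {poly K}) : (1 < size f)%N ->
  exists2 r, irreducible_poly r & r %| f.
Proof.
have [k] := ubnP (size f); elim: k => // k IH in f * => fk f1.
have [|] := pselect (irreducible_poly f); first by exists f.
move=> hirr; have [q [q1 qf qnf]] : exists q : {poly K}, [/\ size q != 1%N, q %| f & ~~ (q %= f)].
  apply: contrapT => hno; apply: hirr; split => // q q1 qf.
  by apply: contrapT => /negP h; apply: hno; exists q.
have f0 : f != 0 by rewrite -size_poly_gt0 (ltn_trans _ f1).
have q0 : q != 0 by apply: contraNneq f0 => q0; rewrite q0 dvd0p in qf.
have [||r r1 rq] := IH q.
- rewrite (leq_trans _ (_ : size f <= k)%N) // ltn_neqAle dvdp_leq // andbT.
  by rewrite dvdp_size_eqp.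
- by rewrite ltn_neqAle eq_sym q1 size_poly_gt0.
by exists r => //; exact: dvdp_trans rq qf.
Qed.

(** Induction on the degree, adjoining one root of an irreducible factor at a time; the resulting
    tower is read as an extension of the bottom field by [baseFieldType]. *)
Lemma splitting_ext (K : fieldType) (f : {poly K}) : f != 0 ->
  exists (L : fieldExtType K) (rs : seq L),
    map_poly (in_alg L) f %= \prod_(z <- rs) ('X - z%:P).
Proof.
have [k] := ubnP (size f); elim: k => // k IH in K f * => fk f0.
have [f1|f1] := leqP (size f) 1.
  exists K^o, [::]; rewrite big_nil -size_poly_eq1 size_map_poly eqn_leq f1.
  by rewrite size_poly_gt0.
have [r irr_r rf] := irreducible_factor f1.
have [K1 _ [x rx _]] := irredp_FAdjoin irr_r.
have : root (map_poly (in_alg K1) f) x.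
  by rewrite -(divpK rf) rmorphM rootM rx orbT.
case/factor_theorem => q fq.
have sq : size f = size (q * ('X - x%:P)) by rewrite -fq size_map_poly.
have q0 : q != 0.
  by apply: contraNneq f0 => q0; rewrite -size_poly_eq0 sq q0 mul0r size_poly0.
have [||L [rs hrs]] := IH K1 q; [|by []|].
  by rewrite sq size_mul ?polyXsubC_eq0 // size_XsubC addn2 in fk.
suff : exists rs : seq L, map_poly (in_alg L) (map_poly (in_alg K1) f) %=
    \prod_(z <- rs) ('X - z%:P).
  rewrite -map_poly_comp -(eq_map_poly (fun a : K => baseField_scaleE a 1)).
  by exists (baseFieldType L).
exists (x%:A :: rs); rewrite big_cons fq rmorphM /= mulrC.
by rewrite rmorphB /= map_polyX map_polyC /= eqp_mull.
Qed.

(** One splitting field of the product of X^n - 1 and X^m - c supplies both elements. As X^n - 1 is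
    separable, it has n distinct roots, among them a primitive one. *)
Lemma prim_root_ext (K : fieldType) (n m : nat) (c : K) :
  (0 < n)%N -> n%:R != 0 :> K -> (0 < m)%N ->
  exists (L : fieldExtType K) (z w : L), n.-primitive_root z /\ w ^+ m = c%:A.
Proof.
move=> n0 nK m0.
have a0 : 'X^n - 1 != 0 :> {poly K} by exact/monic_neq0/monicXnsubC.
have b0 : 'X^m - c%:P != 0 :> {poly K} by exact/monic_neq0/monicXnsubC.
have [|L [rs hrs]] := @splitting_ext K (('X^n - 1) * ('X^m - c%:P)).
  exact: mulf_neq0.
have hX k (d : K) : map_poly (in_alg L) ('X^k - d%:P) = 'X^k - (d%:A)%:P.
  by rewrite rmorphB /= map_polyXn map_polyC.
move: hrs; rewrite rmorphM /= -polyC1 !hX scale1r polyC1 => hrs.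
have /dvdp_prod_XsubC [m1 h1] : 'X^n - 1 %| \prod_(z <- rs) ('X - z%:P).
  by rewrite -(eqp_dvdr _ hrs) dvdp_mulr.
have /dvdp_prod_XsubC [m2 h2] : 'X^m - (c%:A)%:P %| \prod_(z <- rs) ('X - z%:P).
  by rewrite -(eqp_dvdr _ hrs) dvdp_mull.
have nL : n%:R != 0 :> L by rewrite -(rmorph_nat (in_alg L)) fmorph_eq0.
set s1 := mask m1 rs in h1; set s2 := mask m2 rs in h2.
have sz1 : size s1 = n.
  by have /eqp_size := h1; rewrite size_prod_XsubC size_XnsubC // => -[].
have u1 : uniq s1.
  by rewrite -separable_prod_XsubC -(eqp_separable h1) separable_Xn_sub_1.
have r1 : all n.-unity_root s1.
  apply/allP => x xs; rewrite /root_of_unity (eqp_root h1) root_prod_XsubC.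
  exact: xs.
have /hasP [z _ hz] : has n.-primitive_root s1 by rewrite cyclic.has_prim_root // sz1.
have : size s2 = m.
  by have /eqp_size := h2; rewrite size_prod_XsubC size_XnsubC // => -[].
case: s2 h2 => [|w s2] h2 sz2; first by rewrite -sz2 in m0.
exists L, z, w; split => //.
have : root ('X^m - (c%:A)%:P) w by rewrite (eqp_root h2) root_prod_XsubC mem_head.
by rewrite /root !hornerE subr_eq0 => /eqP.
Qed.

(** * Counting *)

Lemma card_image_fin (T : finType) (U : Type) (f : T -> U) (B : {set T}) :
  injective f -> ([set f x | x in [set x | x \in B]] #= `I_#|B|)%card.
Proof.
move=> f_inj; have [B0|[x0 x0B]] := set_0Vmem B.
  rewrite B0 cards0 (_ : [set f x | x in _] = set0) ?II0 //.
  by apply/seteqP; split => y //= [x]; rewrite finset.in_set0.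
pose h k := f (nth x0 (enum B) k).
suff -> : [set f x | x in [set x | x \in B]] = [set h k | k in `I_#|B|].
  apply: inj_card_eq => i j; rewrite !inE /= cardE => hi hj /f_inj /eqP.
  by rewrite nth_uniq ?enum_uniq // => /eqP.
apply/seteqP; split => y /= [x xB <-]; last first.
  by exists (nth x0 (enum B) x) => //; rewrite -mem_enum mem_nth // -cardE.
by exists (index x (enum B)); rewrite /h ?nth_index ?cardE ?index_mem ?mem_enum.
Qed.

(** Restriction to the g - 1 coordinates other than [j] is injective on [B]. *)
Lemma card_bad_functions (g p : nat) (j : 'I_g) (B : {set {ffun 'I_g -> 'I_p}}) :
  (forall c d, c \in B -> d \in B -> (forall i, i != j -> c i = d i) -> c = d) ->
  (#|B| <= p ^ (g - 1))%N.
Proof.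
move=> hB; pose X := {ffun {i : 'I_g | i != j} -> 'I_p}.
pose h (c : {ffun 'I_g -> 'I_p}) : X := [ffun i => c (val i)].
have -> : (p ^ (g - 1))%N = #|{: X}|.
  rewrite card_ffun card_ord card_sig; congr (_ ^ _)%N.
  by rewrite (cardC1 j : #|[pred i | i != j]| = _) card_ord subn1.
rewrite -(card_in_imset (f := h) (D := B)); first exact: max_card.
move=> c d cB dB /ffunP e; apply: hB => // i ij.
by have := e (exist _ i ij); rewrite !ffunE.
Qed.

(** * Gaps and the matrix of index 0 *)

(** The largest gap carrying a nonzero coefficient would be the degree of [a], but gaps are not
    degrees. *)
Lemma gap_part_unique (K : fieldType) (A : set (int -> K)) (g : nat)
    (mu : 'I_g -> nat) (a : int -> K) :
  is_gap_sequence A mu -> A a ->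
  (forall i, 0 <= i -> a i != 0 -> exists k, i = (mu k)%:Z) ->
  forall k, a (mu k)%:Z = 0.
Proof.
move=> [_ hmu] Aa ha k0; apply: contrapT => /eqP a0.
have [k ak kmax] := arg_maxnP (P := fun k => a (mu k)%:Z != 0) mu a0.
have : [set m : nat | ~ degrees A m%:Z] (mu k) by rewrite -hmu; exists k.
apply; exists a => //; split; first exact/eqP.
move=> i ki; apply: contrapT => /eqP ai.
have [|l il] := ha i _ ai; first by apply: le_trans (ltW ki).
have lk : (mu l <= mu k)%N by apply: kmax; rewrite -il.
by move: ki; rewrite il ltz_nat ltnNge lk.
Qed.

(** For k = 0 the component in [A] has its nonnegative exponents among the gaps only, so its
    coefficients there vanish; they are the entries of 1 - e^(0). *)
Lemma e_matrix0 (R : realType) (K : fieldType) (abs : K -> R) (p g : nat)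
    (A : set (int -> K)) (mu : 'I_g -> nat) (e : nat -> 'M[K]_g) :
  is_gap_sequence A mu -> is_e_matrices abs p A mu e -> e 0%N = 1%:M.
Proof.
move=> hmu he; have [_ h] := he 0%N; apply/matrixP => i j.
have [a [t [[Aa _] [t0 _] eq_at]]] := h j; rewrite expn0 muln1 in eq_at.
have aE m : 0 <= m -> a m =
    (m == (mu j)%:Z)%:R - \sum_(k < g) e 0%N k j * (m == (mu k)%:Z)%:R.
  move=> m0; have := congr1 (fun f => f m) eq_at.
  by rewrite /= !fctE fct_sumE t0 // addr0 => <-.
have mu_inj : injective mu.
  have [mono _] := hmu; move=> k l kl; apply/ord_inj.
  by case: (ltngtP k l) => // /mono; rewrite kl ltnn.
have a0 : a (mu i)%:Z = 0.
  apply: (gap_part_unique hmu Aa) => m m0; rewrite aE // => am.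
  apply: contrapT => hno; move: am.
  have mk k : (m == (mu k)%:Z) = false by apply/negP => /eqP e1; apply: hno; exists k.
  by rewrite mk sub0r big1 ?oppr0 ?eqxx // => k _; rewrite mk mulr0.
move: a0; rewrite aE // eqz_nat (inj_eq mu_inj) mxE => /eqP.
rewrite subr_eq0 => /eqP ->; rewrite (bigD1 i) //= eqxx mulr1 big1 ?addr0 // => k ki.
by rewrite eqz_nat (inj_eq mu_inj) eq_sym (negbTE ki) mulr0.
Qed.

(** * Counting the elements of T_1 *)

Section Counting.
Variables (R : realType) (p g : nat) (K : fieldType) (L : fieldExtType K).
Variables (abs : L -> R) (e : nat -> 'M[K]_g) (w : L) (P : 'M[L]_g).
Local Notation E := (fun k => map_mx (in_alg L) (e k)).
Hypotheses (hL : is_abs abs) (hp : prime p) (absp : abs p%:R < 1).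
Hypotheses (p_neq0 : (p%:R : L) != 0) (cL : abs_complete abs).
Hypotheses (hw : w ^+ p.-1 = - p%:R) (E0 : E 0%N = 1%:M).
Hypothesis Eint : forall k, mxint abs (E k).
Hypotheses (Pint : mxint abs P) (detP : abs (\det P) = 1).
Hypothesis (hP : mxcong abs (E 1%N *m mxfrob p P) P).

Let w0 : 0 < abs w. Proof. exact: (abs_root_gt0 (p := p)). Qed.

Lemma radius_root : radius p abs = abs w.
Proof.
have p1 : (0 < p.-1)%N by rewrite -subn1 subn_gt0 prime_gt1.
have -> : radius p abs = (abs w ^+ p.-1) `^ (p.-1)%:R^-1.
  by rewrite -(absX hL) hw (absN hL).
rewrite -powR_mulrn ?ltW // -powRrM divff ?powRr1 ?ltW //.
by rewrite pnatr_eq0 -lt0n.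
Qed.

Lemma T1_log_zero (y : 'cV[L]_g) :
  T1 p e abs (w *: y) <-> mxint abs y /\ log_zero abs p w E y.
Proof.
have part n : l_partial p e (w *: y) n = w *: log_sum p w E n y.
  exact: (log_sum_scale hp w E n y).
have w1 : abs w < 1 by exact: (abs_root_lt1 (p := p)).
have yint_eq i : (abs ((w *: y) i 0) <= abs w) = (abs (y i 0) <= 1).
  by rewrite mxE (abs_mul hL) ger_pMr.
split=> [[_ hl]|[hy hz]].
  rewrite radius_root => /bigmax_leP [_ hr]; split=> [i j|i].
    by rewrite ord1 -yint_eq hr.
  apply: (abs_cvgP hL) => r r0.
  have [|N hN] := abs_cvg_lt hL (hl i) (r := abs w * r); first exact: mulr_gt0.
  exists N => n /hN; rewrite part [X in abs (X - _)]mxE.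
  rewrite [(0 : 'cV[L]_g) i 0]mxE !subr0.
  by rewrite (abs_mul hL) ltr_pM2l.
have hr i : abs ((w *: y) i 0) <= abs w by rewrite yint_eq hy.
split=> [i|i|]; first exact: le_lt_trans (hr i) w1.
  apply: (abs_cvgP hL) => r r0.
  have [|N hN] := abs_cvg_lt hL (hz i) (r := r / abs w); first exact: divr_gt0.
  exists N => n /hN hn; rewrite part [X in abs (X - _)]mxE.
  rewrite [(0 : 'cV[L]_g) i 0]mxE; move: hn; rewrite !subr0.
  by rewrite (abs_mul hL) ltr_pdivlMr // mulrC.
rewrite radius_root; apply/bigmax_leP; split=> [|i _]; first exact: ltW.
exact: hr.
Qed.

Lemma T1_count (hg : (1 <= g)%N) :
  (T1 p e abs #= `I_(p ^ g))%card /\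
  (`I_(p ^ g - p ^ (g - 1)) #<=
    [set x | T1 p e abs x /\ abs (x (last_ord hg) 0) = radius p abs])%card.
Proof.
have [f [f_inj hf fP]] := log_zero_param hL hp absp p_neq0 cL hw E0 Eint Pint detP hP.
have wn0 : w != 0 by apply/negP => /eqP e0; move: w0; rewrite e0 (abs0 hL) ltxx.
pose h c := w *: f c.
have h_inj : injective h by move=> c d /(scalerI wn0) /f_inj.
have hT x : T1 p e abs x <-> exists c, x = h c.
  have xE : x = w *: (w^-1 *: x) by rewrite scalerA divff // scale1r.
  split=> [|[c ->]].
    by rewrite xE => /T1_log_zero /hf [c ->]; exists c.
  by apply/T1_log_zero/hf; exists c.
split.
  have -> : T1 p e abs = [set h x | x in [set x | x \in [set: {ffun 'I_g -> 'I_p}]%SET]].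
    apply/seteqP; split=> x /=; first by case/hT=> c ->; exists c; rewrite ?finset.in_setT.
    by case=> c _ <-; apply/hT; exists c.
  have := card_image_fin [set: {ffun 'I_g -> 'I_p}]%SET h_inj.
  by rewrite cardsT card_ffun !card_ord.
set j0 := last_ord hg.
(* The digit vectors whose solution has a non-unit last coordinate; all others give elements on the
   boundary of the disc. *)
pose B : {set {ffun 'I_g -> 'I_p}} := [set c | abs ((P *m digit_col L c) j0 0) < 1]%SET.
have dint c : abs ((P *m digit_col L c) j0 0) <= 1.
  by apply: (mxint_mul hL) => //; exact: digit_col_int.
have hB c : c \in (~: B)%SET -> abs (h c j0 0) = radius p abs.
  rewrite !finset.inE -leNgt => h1; rewrite radius_root mxE (abs_mul hL).
  rewrite (abs_eq1_cong hL (fP c j0 0)) ?mulr1 //.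
  by apply: le_anti; rewrite dint.
(* Expanding the unit \det P along its last row yields a unit entry in that row. *)
have [j hj] : exists j, abs (P j0 j) = 1.
  apply: contrapT => hno; move: detP; rewrite (expand_det_row _ j0); apply/eqP.
  rewrite lt_eqF //; apply: (abs_sum_lt hL) => // j _; apply: (absM_lt1l hL).
    by rewrite lt_neqAle Pint andbT; apply/negP => /eqP e1; apply: hno; exists j.
  by have := adj_le1 hL Pint j j0; rewrite mxE.
have cB : (#|B| <= p ^ (g - 1))%N.
  apply: (card_bad_functions (j := j)) => c d; rewrite !finset.inE => hc hd cd.
  (* For two vectors of [B] that agree outside [j], the difference of the last coordinates is this
     single product, so the unit entry forces the digits at [j] to agree. *)
  have : abs (P j0 j * ((c j : nat)%:R - (d j : nat)%:R)) < 1.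
    have -> : P j0 j * ((c j : nat)%:R - (d j : nat)%:R) =
        (P *m digit_col L c) j0 0 - (P *m digit_col L d) j0 0.
      rewrite !mxE -sumrB (bigD1 j) //= big1 ?addr0; first by rewrite !mxE mulrBr.
      by move=> i ij; rewrite !mxE cd // subrr.
    exact: absB_lt.
  rewrite (abs_mul hL) hj mul1r => /(digit_inj hL hp absp) ecd.
  by apply/ffunP => i; have [->//|/cd] := eqVneq i j.
apply: (@card_le_trans _ _ _ `I_#|(~: B)%SET|).
  by rewrite card_le_II cardsCs finset.setCK card_ffun !card_ord leq_sub2l.
have := card_image_fin (~: B)%SET h_inj; rewrite card_eq_le => /andP [_ le1].
apply: card_le_trans le1 _; apply: subset_card_le => x /= [c cB' <-]; split.
  by apply/hT; exists c.
exact: hB.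
Qed.

End Counting.

(** * Choice of the extension and conclusion *)

Lemma abs_extends_nat (R : realType) (F : fieldType) (L : fieldExtType F)
    (abs : F -> R) (absL : L -> R) n :
  abs_extends abs absL -> absL n%:R = abs n%:R.
Proof. by move=> [_ h]; rewrite -h scaler_nat. Qed.

(** The extension is built directly over the bottom field, where compactness is available; its
    restriction to the middle field is [absK] by uniqueness. *)
Lemma abs_extension_tower (R : realType) (F : fieldType) (abs : F -> R)
    (K : fieldExtType F) (absK : K -> R) (L : fieldExtType K) :
  is_abs abs -> abs_complete abs -> totally_bounded abs -> abs_extends abs absK ->
  exists2 absL : L -> R, abs_extends absK absL & abs_complete absL.
Proof.
move=> hF cF tF hK.
have [absL hL] := abs_extension_exists hF (baseFieldType L) cF tF.
have cL := abs_extends_complete hF cF tF hL.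
have [a0 a1] := hL.
have aL : @is_abs R L absL by case: a0 => b1 b2 b3 b4; split.
exists absL; last exact: cL.
split => // x.
have h : abs_extends abs (fun x : K => absL (x%:A : L)).
  split; last by move=> a; rewrite -(a1 a) baseField_scaleE.
  split=> [y|y|y z|y z].
  - exact: abs_ge0.
  - rewrite (abs_eq0 aL); split=> [|->]; last by rewrite scale0r.
    by move/eqP; rewrite scaler_eq0 oner_eq0 orbF => /eqP.
  - by rewrite -(abs_mul aL) -(rmorphM (in_alg L)).
  - by rewrite scalerDl (abs_ultra aL).
by rewrite (abs_extends_unique hF cF tF hK h).
Qed.

Theorem proposition3p11 (R : realType) (p : nat) (hp : prime p)
  (Qp : fieldType) (absQp : Qp -> R) (hQp : is_Qp p absQp)
  (K : fieldExtType Qp) (absK : K -> R) (hK : abs_extends absQp absK)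
  (A : set (int -> K)) (hA : is_subalgebra A)
  (hAK : A `&` @power_series K = @constants K)
  (g : nat) (hg : (1 <= g)%N)
  (hdim : quotient_dim (@laurent K) (setsum A (@power_series K)) g)
  (hint : strictly_integral absK A)
  (mu : 'I_g -> nat) (hmu : is_gap_sequence A mu)
  (e : nat -> 'M[K]_g) (he : is_e_matrices absK p A mu e)
  (hdet : integer_units absK (\det (e 1%N))) :
  exists (K' : fieldExtType K) (absK' : K' -> R),
    abs_extends absK absK' /\
    (T1 p e absK' #= `I_(p ^ g))%card /\
    (`I_(p ^ g - p ^ (g - 1)) #<=
      [set x | T1 p e absK' x /\ absK' (x (last_ord hg) 0) = radius p absK'])%card.
Proof.
have hF := Qp_abs hQp; have cF := Qp_complete hQp.
have tF := Qp_totally_bounded hp hQp; have pitv := Qp_abs_prime_itv hp hQp.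
have [aK _] := hK.
have /andP [pK0 pK1] : 0 < absK p%:R < 1 by rewrite (abs_extends_nat p hK).
have eint k : mxint absK (e k) by case: (he k).
have det1 : absK (\det (e 1%N)) = 1.
  have [d1 [b b1 db]] := hdet; apply: le_anti; rewrite [X in X && _]d1 /=.
  have := abs_mul aK (\det (e 1%N)) b; rewrite db (abs1 aK) => ->.
  by rewrite ler_piMr // (abs_ge0 aK).
(* Distance below 1 means congruence modulo the maximal ideal, so this is the finiteness of the
   residue field of K. *)
have [T [cl hcl]] := abs_extends_totally_bounded hF cF tF hK pitv ltr01.
have [N N0 hN] := frob_iter_period aK hp pK1 (eint 1%N) det1 hcl.
have n0 : (0 < (p ^ N).-1)%N.
  by rewrite -subn1 subn_gt0 -{1}(expn0 p) ltn_exp2l // prime_gt1.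
have nK : ((p ^ N).-1%:R : K) != 0.
  rewrite -(rmorph_nat (in_alg K)) fmorph_eq0 pmulrn (Qp_intr_neq0 hp hQp) //.
  by rewrite eqz_nat -lt0n.
have p1 : (0 < p.-1)%N by rewrite -subn1 subn_gt0 prime_gt1.
(* K' contains the roots of unity for Lang's theorem and a root [w] for the rescaling of the
   logarithm. *)
have [L [z [w [hz hw]]]] := prim_root_ext (- p%:R) n0 nK p1.
have [absL hL cL] := abs_extension_tower L hF cF tF hK.
exists L, absL; split => //.
have [aL aLK] := hL.
have pL : absL p%:R = absK p%:R by exact: abs_extends_nat hL.
have pL1 : absL p%:R < 1 by rewrite pL.
have p_neq0 : (p%:R : L) != 0.
  by apply/negP => /eqP p0; move: pK0; rewrite -pL p0 (abs0 aL) ltxx.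
have {}hw : w ^+ p.-1 = - p%:R by rewrite hw scaleNr scaler_nat.
have Eint k : mxint absL (map_mx (in_alg L) (e k)).
  by move=> i j; rewrite mxE [absL _]aLK eint.
have [P [Pint detP hP]] : exists P : 'M[L]_g, [/\ mxint absL P, absL (\det P) = 1
    & mxcong absL (map_mx (in_alg L) (e 1%N) *m mxfrob p P) P].
  apply: (lang_matrix aL hp pL1 (Eint 1%N) N0 _ hz).
  rewrite -map_frob_iter => i j; have := hN i j; rewrite -aLK.
  by rewrite !mxE scalerBl scaler_nat.
apply: (T1_count aL hp pL1 p_neq0 cL hw _ Eint Pint detP hP).
by rewrite (e_matrix0 hmu he) map_mx1.
Qed.
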